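(* Let $q=p^r\ge 3$ be a prime power, let $k$ be an integer with $1\le k<q-1$ and let $c\in\mathbb{F}_q^*$. Let $f(x)$ and $f(x)+cx^k$ be permutation polynomials of $\mathbb{F}_q$, where $\mathrm{Crk}(f)=n\ge 1$ and $f\in\mathcal{L}_2$. Put $m=\gcd(k+1,q-1)$. Then $$k(n+3)+(k-1)(m-1)\sqrt{q}\;\geq\; q-n.$$ In particular, if $m=1$, then $k\geq (q-n)/(n+3)$.
   Context: Let $q=p^r\ge 3$, with $p$ prime and $r\ge 1$. A polynomial $f\in\mathbb{F}_q[x]$ is a permutation polynomial of $\mathbb{F}_q$ if the map $c\mapsto f(c)$ is a bijection of $\mathbb{F}_q$. Carlitz rank. By a theorem of Carlitz, every permutation of $\mathbb{F}_q$ is induced by a polynomial of the form $$P_n(a_0,\dots,a_{n+1};x)=\left(\ldots\left(\left(a_0x+a_1\right)^{q-2}+a_2\right)^{q-2}\ldots+a_n\right)^{q-2}+a_{n+1}$$ for some $n\ge 0$ and $a_0,\dots,a_{n+1}\in\mathbb{F}_q$ with $a_i\neq 0$ for $i=0,2,\ldots,n$. (Here $n$ is the number of times the power map $x\mapsto x^{q-2}$ is applied; for $n=0$ the expression is the linear polynomial $a_0x+a_1$.) We say that $f$ is represented by $P_n$ if $f(c)=P_n(a_0,\dots,a_{n+1};c)$ for all $c\in\mathbb{F}_q$. The representation need not be unique. The Carlitz rank $\mathrm{Crk}(f)$ of a permutation polynomial $f$ is the smallest $n\ge 0$ for which $f$ is represented by some $P_n$ of this form. The classes $\mathcal{L}_1$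 and $\mathcal{L}_2$. Given $a_0,\dots,a_{n+1}\in\mathbb{F}_q$ with $a_i\neq 0$ for $i=0,2,\ldots,n$, define $\alpha_0=0$, $\alpha_1=a_0$, $\beta_0=1$, $\beta_1=a_1$ and, for $k\ge 2$, $$\alpha_k=a_k\alpha_{k-1}+\alpha_{k-2},\qquad \beta_k=a_k\beta_{k-1}+\beta_{k-2}.$$ The elements $x_k=-\beta_k/\alpha_k\in\mathbb{F}_q\cup\{\infty\}$, $k=1,\dots,n$, are called the poles, and $x_n$ is the last pole. $\mathcal{L}_1$ is the set of all permutation polynomials $f$ of $\mathbb{F}_q$ with $\mathrm{Crk}(f)=n\geq 1$ that have a representation $P_n(a_0,\dots,a_{n+1};x)$ (with $n=\mathrm{Crk}(f)$) for which $\alpha_n\neq 0$; equivalently, the associated fractional linear transformation $R_n(x)=\frac{\alpha_{n+1}x+\beta_{n+1}}{\alpha_nx+\beta_n}$ is not linear. $\mathcal{L}_2$ is the set of $f\in\mathcal{L}_1$ whose last pole $x_n$ is $0$, i.e. those with such a representation (with $n=\mathrm{Crk}(f)\ge 1$) satisfying $\alpha_n\ne 0$ and $\beta_n=0$. *)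

(* Defs.v *)
From mathcomp Require Import all_boot all_order all_algebra all_field.

Set Implicit Arguments.
Unset Strict Implicit.
Unset Printing Implicit Defensive.

Import Order.TTheory GRing.Theory Num.Theory.
Local Open Scope ring_scope.

Definition permutation_poly (F : finFieldType) (f : {poly F}) : Prop :=
  bijective (fun c : F => f.[c]).

(* The coefficients a_0, ..., a_{n+1} are given by a sequence a : nat -> F;
   its values at indices larger than n + 1 are never used.  Here n is the
   number of applications of the power map x |-> x^(q-2), where q = #|F|. *)
Fixpoint carlitz_poly (F : finFieldType) (a : nat -> F) (n : nat) : {poly F} :=
  if n is n'.+1 then carlitz_poly a n' ^+ (#|F| - 2) + (a n.+1)%:P
  else (a 0) *: 'X + (a 1)%:P.

Definition admissible (F : finFieldType) (a : nat -> F) (n : nat) : Prop :=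
  a 0 != 0 /\ forall i : nat, (2 <= i <= n)%N -> a i != 0.

(* f is represented by P_n(a_0, ..., a_{n+1}; x): equality as maps on F. *)
Definition represents (F : finFieldType) (a : nat -> F) (n : nat)
    (f : {poly F}) : Prop :=
  admissible a n /\ forall c : F, f.[c] = (carlitz_poly a n).[c].

(* The relation Crk(f) = n. *)
Definition is_carlitz_rank (F : finFieldType) (f : {poly F}) (n : nat) : Prop :=
  (exists a : nat -> F, represents a n f) /\
  (forall (n' : nat) (a : nat -> F), represents a n' f -> (n <= n')%N).

Fixpoint alpha (F : finFieldType) (a : nat -> F) (k : nat) : F :=
  match k with
  | 0 => 0
  | 1 => a 0
  | (k2.+1 as k1).+1 => a k * alpha a k1 + alpha a k2
  end.

Fixpoint beta (F : finFieldType) (a : nat -> F) (k : nat) : F :=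
  match k with
  | 0 => 1
  | 1 => a 1
  | (k2.+1 as k1).+1 => a k * beta a k1 + beta a k2
  end.

(* Only meaningful when alpha a k != 0; otherwise the k-th pole is infinity,
   whereas this expression is 0 because 0^-1 = 0. *)
Definition pole (F : finFieldType) (a : nat -> F) (k : nat) : F :=
  - (beta a k / alpha a k).

Definition class_L1 (F : finFieldType) (f : {poly F}) : Prop :=
  permutation_poly f /\
  exists n : nat, [/\ (1 <= n)%N, is_carlitz_rank f n &
    exists a : nat -> F, represents a n f /\ alpha a n != 0].

(* The finiteness condition alpha a n != 0 is repeated because the
   representation with last pole 0 has to be the one witnessing L_1. *)
Definition class_L2 (F : finFieldType) (f : {poly F}) : Prop :=
  class_L1 f /\
  exists n : nat, [/\ (1 <= n)%N, is_carlitz_rank f n &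
    exists a : nat -> F, [/\ represents a n f, alpha a n != 0 & pole a n = 0]].

(* Main.v *)
From HB Require Import structures.
Require Import Defs.
From mathcomp Require Import all_boot all_order all_algebra all_field.
From mathcomp Require Import abelian cyclic.
From mathcomp Require Import zify ring lra.

(* Idea.  If a permutation of Carlitz rank n has last pole 0, it agrees with
   A + B/x (B != 0) outside a set of at most n points containing 0, so
   g(x) = B/x + c x^k is injective there and has at most (n - 1)(k + 1) ordered
   pairs of distinct points of F^* with the same value.  Putting
   x = 1/z and y = t/z, such pairs are the solutions with t != 1 of
   z^(k+1) B/c = h(t), where h(t) = t (1 + t + ... + t^(k-1)); expanding in the
   characters chi with chi^m = 1, the number of solutions is q - O(k) plus
   m - 1 sums of the form sum_t chi(h(t)), and Weil's bound (k - 1) sqrt(q)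
   for these finishes the proof.

   Weil's bound: over monic polynomials G, the function
   lam(G) = chi(prod_(h(x) = 0) G(x)) is multiplicative and depends on G mod h
   only, so its generating series is a polynomial prod (1 - z_i T) with at most
   k - 1 factors, the sum over F being - sum z_i up to a root of unity.  By the
   Euler product, - sum z_i^nu is the analogous character sum over the field
   with q^nu elements, and the Stepanov-Bombieri argument gives O(q^(nu/2)) for
   it when nu is even; hence |z_i| <= sqrt(q). *)

Set Implicit Arguments.
Unset Strict Implicit.
Unset Printing Implicit Defensive.

Import Order.TTheory GRing.Theory Num.Theory.
Local Open Scope ring_scope.

(** * Linear algebra of polynomials *)

(** There are more polynomials than the dimension of the space containing them, so the matrix of
    their coefficient rows has a nonzero left kernel. *)
Lemma exists_poly_relation (K : fieldType) (I : finType) (V : I -> {poly K})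
    (n : nat) :
  (forall i, (size (V i) <= n)%N) -> (n < #|I|)%N ->
  exists2 w : I -> K, exists i, w i != 0 & \sum_i w i *: V i = 0.
Proof.
move=> sV ltn; pose W : 'M[K]_(#|I|, n) := \matrix_i poly_rV (V (enum_val i)).
have : kermx W != 0.
  rewrite kermx_eq0 /row_free neq_ltn; apply/orP; left.
  exact: leq_ltn_trans (rank_leq_col W) ltn.
case/matrix0Pn=> i0 [j0 nz]; exists (fun i => kermx W i0 (enum_rank i)).
  by exists (enum_val j0); rewrite enum_valK.
have /(congr1 (row i0)) := mulmx_ker W; rewrite row_mul row0 => /rowP eqW.
apply/polyP => l; rewrite coef0 coef_sum; have [ln|nl] := ltnP l n.
  transitivity ((row i0 (kermx W) *m W) 0 (Ordinal ln)); last by rewrite eqW mxE.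
  rewrite mxE (reindex (@enum_val _ I)) /=; last first.
    by apply: onW_bij; apply: enum_val_bij.
  by apply: eq_bigr => i _; rewrite coefZ !mxE enum_valK.
by rewrite big1 // => i _; rewrite coefZ nth_default ?mulr0 // (leq_trans (sV i)).
Qed.

(** Among the terms with nonzero coefficient, the one of largest size is alone in its leading
    degree, so nothing cancels it. *)
Lemma lin_indep_of_distinct_sizes (K : fieldType) (I : finType)
    (V : I -> {poly K}) (c : I -> K) :
  (forall i, V i != 0) -> injective (fun i => size (V i)) ->
  (exists i, c i != 0) -> \sum_i c i *: V i != 0.
Proof.
move=> V0 injV [i0 ci0].
have [i ci maxi] := @arg_maxnP _ i0 (fun i => c i != 0) (fun i => size (V i)) ci0.
apply/eqP => /(congr1 (fun p : {poly K} => p`_(size (V i)).-1)).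
rewrite coef0 coef_sum (bigD1 i) //= big1 => [|j ji].
  rewrite addr0 coefZ => /eqP; rewrite mulf_eq0 (negPf ci) /= -lead_coefE.
  by rewrite lead_coef_eq0 (negPf (V0 i)).
have [->|cj] := eqVneq (c j) 0; first by rewrite coefZ mul0r.
rewrite coefZ nth_default ?mulr0 //.
have : size (V j) != size (V i) by apply: contra ji => /eqP /injV ->.
rewrite neq_ltn => /orP[lt|]; first by rewrite -ltnS prednK // lt0n size_poly_eq0.
by rewrite ltnNge (maxi j cj : (size (V j) <= size (V i))%N).
Qed.

Lemma exprDn_sum_pchar (R : comNzRingType) (I : Type) (r : seq I) (E : I -> R) (s : nat) :
  [pchar R].-nat s -> (\sum_(i <- r) E i) ^+ s = \sum_(i <- r) E i ^+ s.
Proof.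
move=> hs; elim: r => [|i r IH]; last by rewrite !big_cons exprDn_pchar // IH.
by rewrite !big_nil expr0n; case: s hs.
Qed.

Lemma exists_root_pow (K : closedFieldType) (s : nat) (w : K) :
  (0 < s)%N -> exists c, c ^+ s = w.
Proof.
move=> s0; have : size ('X^s - w%:P) != 1%N by rewrite size_XnsubC // eqSS -lt0n.
move=> /closed_rootP [c]; rewrite rootE !hornerE => /eqP h; exists c; exact: (subr0_eq h).
Qed.

(** The right side counts the unknown coefficients in Stepanov's argument, the left side the linear
    conditions on them. Their difference is [s1 (2 m - 2 + k) - m k (k + 1)]. *)
Lemma stepanov_arith (A J m k s s1 : nat) :
  (0 < m)%N -> (0 < k)%N -> (k * m * (k + 1) < s1)%N -> s = (m * s1 + 1)%N ->
  A = (s1 - k)%N -> J = (s1 + k + 1)%N ->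
  (s * (A - 1) + (J - 1) + (m - 1) * (k * s1) + 1 < J * m * A)%N.
Proof.
move=> m0 k0 hs -> -> ->.
have hk : (k < s1)%N by apply: leq_ltn_trans hs; nia.
have [A1 EA] : exists A1, (s1 = k + A1 + 1)%N by exists (s1 - k - 1)%N; lia.
have [m1 Em] : exists m1, m = m1.+1 by exists m.-1; lia.
have [k1 Ek] : exists k1, k = k1.+1 by exists k.-1; lia.
subst s1 m k; rewrite (_ : k1.+1 + A1 + 1 - k1.+1 = A1 + 1)%N; last lia.
rewrite !addnK subn1 /=.
nia.
Qed.

(** * The Stepanov-Bombieri bound *)

(** Multiplied by [m], the exponent becomes [s (m a + b k) + (m i - b k)], where [m i - b k] ranges
    over an interval shorter than [s]. So [m a + b k] is determined; modulo [m] it gives [b], and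
    then [a] and [i] follow. *)
Lemma distinct_degrees (m k s1 s a b i a' b' i' : nat) :
  coprime m k -> (k < s1)%N -> s = (m * s1 + 1)%N ->
  (b < m)%N -> (b' < m)%N -> (i < s1 - k)%N -> (i' < s1 - k)%N ->
  (i + s * a + b * (k * s1) = i' + s * a' + b' * (k * s1))%N ->
  [/\ a = a', b = b' & i = i'].
Proof.
move=> mk ks1 Es bm bm' iA iA' E.
wlog le_ab : a b i a' b' i' bm bm' iA iA' E / (m * a + b * k <= m * a' + b' * k)%N.
  move=> W; have [h|/ltnW h] := leqP (m * a + b * k) (m * a' + b' * k).
    exact: (W a b i a' b' i').
  by have [//|-> -> ->] := W a' b' i' a b i bm' bm iA' iA _ h.
have Em : (m * i + s * (m * a + b * k) + b' * k =
           m * i' + s * (m * a' + b' * k) + b * k)%N by subst s; nia.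
have Eab : (m * a + b * k = m * a' + b' * k)%N.
  apply/eqP; rewrite eqn_leq le_ab leqNgt; apply/negP => lt.
  have [d Ed] : exists d, (m * a' + b' * k = m * a + b * k + d.+1)%N.
    by exists (m * a' + b' * k - (m * a + b * k)).-1; lia.
  have : (m * i <= m * (s1 - k))%N by nia.
  have : (b' * k >= 0)%N by [].
  have : (m * i + b' * k = m * i' + s * d.+1 + b * k)%N by nia.
  have : (m * i.+1 <= m * (s1 - k))%N by nia.
  have : (b'.+1 * k <= m * k)%N by nia.
  have : (m * (s1 - k) + m * k = m * s1)%N by rewrite -mulnDr subnK // ltnW.
  nia.
have Ebb : b = b'.
  have : (b * k == b' * k %[mod m])%N.
    have := congr1 (modn^~ m) Eab; rewrite ![(m * _)%N]mulnC !modnMDl => ->.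
    exact: eqxx.
  wlog: b b' {le_ab E Em Eab} bm bm' / (b <= b')%N.
    move=> W; have [h|/ltnW h] := leqP b b'; first exact: W.
    by rewrite eq_sym => /W ->.
  move=> le; rewrite eq_sym eqn_mod_dvd ?leq_mul2r ?le ?orbT // -mulnBl.
  rewrite Gauss_dvdl // => /dvdnP [[|t] Et]; first lia.
  by have : (m <= b' - b)%N by [rewrite Et leq_pmull]; lia.
subst b'; have aa : a = a' by apply/eqP; rewrite -(eqn_pmul2l (_ : 0 < m)%N); lia.
by subst a'; split => //; lia.
Qed.

(* Bombieri's version of Stepanov's argument.  Writing F = f^s1, the polynomial
   H = sum c_(a,b,i) X^(i + s a) F^b is nonzero since its terms have distinct
   degrees, while at the points considered x^(s^2) = x and F^(s+1) = e, so
   F^(m-1) H^s is there the value of sum c^s e^b X^(s i + a) F^(m-1-b), whose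
   degree is so small that it can be made to vanish identically. *)
Lemma stepanov_bombieri (K : closedFieldType) (f : {poly K})
    (m k s s1 : nat) (e : K) (xs : seq K) :
  size f = k.+1 -> coprime m k -> (0 < m)%N -> (0 < k)%N ->
  s = (m * s1 + 1)%N -> [pchar K].-nat s -> (k * m * (k + 1) < s1)%N -> e != 0 ->
  uniq xs ->
  (forall x, x \in xs -> x ^+ (s ^ 2) = x /\ f.[x] ^+ (s1 * (s + 1)) = e) ->
  (size xs * m <= s ^ 2 + m * (2 * k + 1) * s)%N.
Proof.
move=> sf mk m0 k0 Es pchs hs e0 uxs hxs.
have ks1 : (k < s1)%N by apply: leq_ltn_trans hs; nia.
pose A := (s1 - k)%N; pose J := (s1 + k + 1)%N.
have arith : (s * (A - 1) + (J - 1) + (m - 1) * (k * s1) + 1 < J * m * A)%N.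
  exact: (@stepanov_arith A J m k s s1).
pose I : finType := ('I_J * 'I_m * 'I_A)%type.
pose F := f ^+ s1.
have f0 : f != 0 by rewrite -size_poly_gt0 sf.
have szXF n b : size ('X^n * F ^+ b) = (n + b * (k * s1)).+1.
  have F0 : F ^+ b != 0 by rewrite !expf_neq0.
  rewrite mulrC size_mulXn //.
  have -> : size (F ^+ b) = (size (F ^+ b)).-1.+1 by rewrite prednK ?size_poly_gt0.
  by rewrite -exprM size_exp sf /=; lia.
pose B (t : I) := 'X^(t.2 + s * t.1.1) * F ^+ t.1.2.
pose C (t : I) := e ^+ t.1.2 *: ('X^(s * t.2 + t.1.1) * F ^+ (m - 1 - t.1.2)).
have [w [t0 wt0] Ew] : exists2 w : I -> K, exists t, w t != 0 & \sum_t w t *: C t = 0.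
  apply: (@exists_poly_relation _ _ C
            (s * (A - 1) + (J - 1) + (m - 1) * (k * s1) + 1)%N) => [[[a b] i]|].
    rewrite /C /=; apply: leq_trans (size_scale_leq _ _) _; rewrite szXF.
    have := ltn_ord a; have := ltn_ord b; have := ltn_ord i.
    move: (nat_of_ord a) (nat_of_ord b) (nat_of_ord i) => a' b' i' hi hb ha.
    have h1 : (s * i' <= s * (A - 1))%N by rewrite leq_mul2l; lia.
    have h2 : ((m - 1 - b') * (k * s1) <= (m - 1) * (k * s1))%N.
      by rewrite leq_mul2r; lia.
    lia.
  by rewrite !card_prod !card_ord.
have s0 : (0 < s)%N by lia.
(* Raising to the power [s] is additive, so with these [s]-th roots as coefficients of [H], the
   power [H ^+ s] is the sum of the [w t *: B t ^+ s]. *)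
have /fin_all_exists [c Ec] t : exists c, c ^+ s = w t by exact: exists_root_pow.
pose H := \sum_t c t *: B t.
have H0 : H != 0.
  apply: lin_indep_of_distinct_sizes => [t||].
  - by rewrite -size_poly_gt0 szXF.
  - move=> [[a b] i] [[a' b'] i']; rewrite !szXF /= => -[].
    move/(@distinct_degrees m k s1 s).
    by case=> // /val_inj -> /val_inj -> /val_inj ->.
  - by exists t0; apply: contraNneq wt0 => ct0; rewrite -Ec ct0 expr0n; case: (s) s0.
have rootH x : x \in xs -> root H x.
  move=> /hxs [xQ fx].
  have Fx : F.[x] ^+ (s + 1) = e by rewrite horner_exp -exprM.
  have Fx0 : F.[x] != 0.
    by apply: contraNneq e0 => F0; rewrite -Fx F0 expr0n addn1.
  (* The factor [F ^+ (m - 1)] does not vanish at [x]; it turns [F ^+ (b * s)] into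
     [e ^+ b * F ^+ (m - 1 - b)], with no negative exponent. *)
  rewrite rootE; suff : H.[x] ^+ s * F.[x] ^+ (m - 1) == 0.
    by rewrite mulf_eq0 !expf_eq0 (negPf Fx0) andbF orbF s0.
  rewrite /H horner_sum exprDn_sum_pchar // mulr_suml.
  have /(congr1 (horner^~ x)) := Ew; rewrite horner_sum horner0 => Ewx.
  apply/eqP; rewrite -[RHS]Ewx; apply: eq_bigr => -[[a b] i] _; rewrite /B /C !hornerE /=.
  have -> : (f.[x] ^+ s1) = F.[x] by rewrite horner_exp.
  have bm : (b <= m - 1)%N by have := ltn_ord b; lia.
  have Ex : (x ^+ (i + s * a)) ^+ s = x ^+ (s * i + a).
    rewrite -exprM mulnDl exprD (mulnC i) exprD; congr (_ * _).
    by rewrite mulnAC mulnn exprM xQ.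
  have Ey : (F.[x] ^+ b) ^+ s * F.[x] ^+ (m - 1) = e ^+ b * F.[x] ^+ (m - 1 - b).
    by rewrite -Fx -!exprM -!exprD; congr (_ ^+ _); rewrite mulnDl mulnC; lia.
  by rewrite !exprMn Ec Ex -!mulrA Ey; ring.
have szH : (size H <= (A - 1) + s * (J - 1) + (m - 1) * (k * s1) + 1)%N.
  apply: leq_trans (size_sum _ _ _) _; apply/bigmax_leqP => -[[a b] i] _.
  apply: leq_trans (size_scale_leq _ _) _; rewrite szXF /=.
  have := ltn_ord a; have := ltn_ord b; have := ltn_ord i.
  move: (nat_of_ord a) (nat_of_ord b) (nat_of_ord i) => a' b' i' hi hb ha.
  have h1 : (s * a' <= s * (J - 1))%N by rewrite leq_mul2l; lia.
  have h2 : (b' * (k * s1) <= (m - 1) * (k * s1))%N by rewrite leq_mul2r; lia.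
  lia.
have : (size xs < size H)%N by apply: max_poly_roots => //; apply/allP.
move=> /leq_trans /(_ szH); rewrite addn1 ltnS => szxs.
apply: (@leq_trans (((A - 1) + s * (J - 1) + (m - 1) * (k * s1)) * m)%N).
  by rewrite leq_mul2r szxs orbT.
rewrite /A /J addnK -mulnn !mulnDl.
have h1 : ((s1 - k - 1) * m <= s)%N.
  rewrite Es mulnC; apply: leq_trans (leq_addr _ _).
  by rewrite leq_mul2l -subnDA leq_subr orbT.
have h2 : (s * (s1 + k) * m + s = s * s + s * k * m)%N.
  by rewrite [in X in _ = (_ * X + _)%N]Es; ring.
have h3 : ((m - 1) * (k * s1) * m <= k * m * s)%N.
  rewrite (_ : (m - 1) * (k * s1) * m = k * m * ((m - 1) * s1))%N; last ring.
  rewrite leq_mul2l; apply/orP; right; rewrite Es.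
  by apply: (@leq_trans (m * s1)%N); rewrite ?leq_addr // leq_mul2r leq_subr orbT.
have h4 : (m * (2 * k + 1) * s = 2 * (k * m * s) + m * s)%N by ring.
have h5 : (s <= m * s)%N by rewrite leq_pmull.
lia.
Qed.

(** * Frobenius orbits in an algebraic closure *)

Section Frobenius.

Variables (F : finFieldType) (K : closedFieldType) (emb : {rmorphism F -> K}).
Local Notation q := #|F|.
Local Notation "p ^emb" := (map_poly emb p) (at level 2, format "p ^emb").

Lemma pchar_nat_card n : [pchar K].-nat (q ^ n)%N.
Proof.
have [p pr_p pF] := finPcharP F.
have qp : p.-nat q by rewrite -cardsT; apply: abelem_pgroup; apply: fin_ring_pchar_abelem pF.
rewrite pnatX; apply/orP; left; rewrite (eq_pnat _ (fmorph_pchar emb)).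
by apply: sub_in_pnat qp => r _; rewrite inE => /eqP ->.
Qed.

Lemma frob_card_inj n : injective (fun x : K => x ^+ (q ^ n)).
Proof.
move=> x y /= Exy; apply/eqP; rewrite -subr_eq0; apply/eqP.
have pn := pchar_nat_card n; have n0 : (0 < q ^ n)%N by case/andP: pn.
have : (x - y) ^+ (q ^ n) + y ^+ (q ^ n) = y ^+ (q ^ n).
  by rewrite -exprDn_pchar // subrK.
by move/(canRL (addrK _)); rewrite subrr => /eqP; rewrite expf_eq0 n0 => /eqP.
Qed.

Lemma exists_frob n :
  exists phi : {rmorphism K -> K}, forall x, phi x = x ^+ (q ^ n).
Proof.
have pn := pchar_nat_card n; have n0 : (0 < q ^ n)%N by case/andP: pn.
pose f (x : K) := x ^+ (q ^ n).
have fD : nmod_morphism f.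
  by split=> [|x y]; rewrite /f ?exprDn_pchar // expr0n; case: (q ^ n)%N n0.
have fM : monoid_morphism f by split=> [|x y]; rewrite /f ?expr1n ?exprMn.
pose A := GRing.isNmodMorphism.Build K K f fD.
pose B := GRing.isMonoidMorphism.Build K K f fM.
by exists (HB.pack f A B : {rmorphism K -> K}).
Qed.

(** ['X^q - 'X] is the product of the ['X - a] over [F], so its image has no further roots in
    [K]. *)
Lemma frob_fixed (y : K) : y ^+ q = y -> exists a, y = emb a.
Proof.
move=> yq; have /(congr1 (map_poly emb)) := finField_genPoly F.
rewrite rmorphB /= map_polyXn map_polyX rmorph_prod /=.
move/(congr1 (horner^~ y)); rewrite horner_prod !hornerE yq subrr.
move/esym/eqP; rewrite prodf_seq_eq0 => /hasP [a _]; rewrite map_polyXsubC !hornerE.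
by rewrite subr_eq0 => /eqP ->; exists a.
Qed.

Lemma emb_fixed n (a : F) : emb a ^+ (q ^ n) = emb a.
Proof.
elim: n => [|n IH]; first by rewrite expn0 expr1.
by rewrite expnS exprM -rmorphXn /= expf_card IH.
Qed.

Lemma horner_frob n (g : {poly F}) (x : K) :
  g^emb.[x] ^+ (q ^ n) = g^emb.[x ^+ (q ^ n)].
Proof.
have [phi Ephi] := exists_frob n.
rewrite -!Ephi -horner_map -map_poly_comp; congr (_ .[_]).
by apply: eq_map_poly => a /=; rewrite Ephi emb_fixed.
Qed.

Lemma root_frob n (g : {poly F}) (x : K) :
  root g^emb (x ^+ (q ^ n)) = root g^emb x.
Proof.
by rewrite /root -horner_frob expf_eq0 expn_gt0 (ltnW (finNzRing_gt1 F)).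
Qed.

(** Frobenius permutes the roots, hence fixes the coefficients of the product, and its fixed points
    come from [F]. *)
Lemma poly_descent (rs : seq K) :
  perm_eq [seq x ^+ q | x <- rs] rs ->
  exists G : {poly F}, G^emb = \prod_(x <- rs) ('X - x%:P).
Proof.
move=> prs; set p := \prod_(x <- rs) _.
have [phi Ephi] := exists_frob 1; rewrite expn1 in Ephi.
have Ep : map_poly phi p = p.
  rewrite rmorph_prod /= -[RHS](perm_big _ prs) big_map; apply: eq_bigr => x _.
  by rewrite map_polyXsubC -Ephi.
have /fin_all_exists [g Eg] (i : 'I_(size p)) : exists a, p`_i = emb a.
  by apply: frob_fixed; rewrite -Ephi -coef_map Ep.
exists (\poly_(i < size p) odflt 0 (omap g (insub i))).
apply/polyP => i; rewrite coef_map coef_poly; case: ltnP => [lt|ge].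
  by rewrite insubT /= -Eg.
by rewrite nth_default ?raddf0.
Qed.

Lemma emb_root_dvdp (G H : {poly F}) (r : seq K) :
  G^emb = \prod_(x <- r) ('X - x%:P) -> uniq r -> all (root H^emb) r -> G %| H.
Proof.
move=> EG ur rH; rewrite -(dvdp_map emb) EG.
have [|p ->] := uniq_roots_prod_XsubC rH; first by rewrite uniq_rootsE.
by rewrite dvdp_mull.
Qed.

(** [G] is the minimal polynomial of [x] over [F], built from the Frobenius orbit. It is irreducible
    because the roots of a polynomial over [F] form a Frobenius-stable set: one root in the orbit
    brings all of it. *)
Lemma frob_orbit (x : K) (n : nat) : (0 < n)%N -> x ^+ (q ^ n) = x ->
  exists G : {poly F}, [/\ G \is monic, irreducible_poly G,
    G^emb = \prod_(y <- [seq x ^+ (q ^ i) | i <- iota 0 (size G).-1]) ('X - y%:P),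
    uniq [seq x ^+ (q ^ i) | i <- iota 0 (size G).-1] &
    forall j, (x ^+ (q ^ j) == x) = ((size G).-1 %| j)%N].
Proof.
move=> n0 xn.
have ex : exists j, (0 < j)%N && (x ^+ (q ^ j) == x) by exists n; rewrite n0 xn eqxx.
case: (ex_minnP ex) => d /andP[d0 /eqP xd] mind {n n0 xn ex}.
have xmul a : x ^+ (q ^ (d * a)) = x.
  by elim: a => [|a IH]; rewrite ?muln0 ?expr1 // mulnS expnD exprM xd.
have period j : (x ^+ (q ^ j) == x) = (d %| j)%N.
  apply/idP/idP => [/eqP xj|/dvdnP[a ->]]; last by rewrite mulnC xmul.
  move: xj; rewrite {1}(divn_eq j d) mulnC expnD exprM xmul => xj.
  rewrite /dvdn; apply: contraLR (ltn_pmod j d0); rewrite -lt0n -leqNgt => r0.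
  by apply: mind; rewrite r0 xj eqxx.
pose r := [seq x ^+ (q ^ i) | i <- iota 0 d].
have ur : uniq r.
  rewrite map_inj_in_uniq ?iota_uniq // => i j; rewrite !mem_iota !add0n /=.
  wlog le : i j / (i <= j)%N.
    by move=> W iP jP E; case/orP: (leq_total i j) => h; [|apply/esym]; apply: W.
  move=> id jd E; apply/eqP; rewrite eqn_leq le -subn_eq0 eqn0Ngt; apply/negP => ji.
  have := mind (j - i)%N; rewrite ji /= => /(_ _)/wrap[|]; last by lia.
  by apply/eqP/(@frob_card_inj i); rewrite -exprM -expnD subnK.
have [|G EG] := @poly_descent r.
  rewrite /r -map_comp; case: (d) d0 xd => // d' _ xd.
  have -> : [seq x ^+ (q ^ i) ^+ q | i <- iota 0 d'.+1] =
            [seq x ^+ (q ^ i) | i <- iota 1 d' ++ [:: d'.+1]].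
    rewrite -[X in _ = map _ X](iotaD 1 d' 1) addn1 (iotaDl 1 0) -map_comp.
    by apply: eq_map => i /=; rewrite -exprM -expnSr.
  by rewrite map_cat perm_catC /= xd expn0 expr1.
have sG : (size G).-1 = d.
  by rewrite -(size_map_poly emb) EG size_prod_XsubC size_map size_iota.
exists G; rewrite sG; split => //.
  by rewrite -(map_monic emb) EG monic_prod_XsubC.
split=> [|H sH HG]; first by rewrite -ltn_predRL sG.
rewrite /eqp HG (emb_root_dvdp EG) //.
have [y Hy] : exists y, root H^emb y by apply/closed_rootP; rewrite size_map_poly.
have : root G^emb y by rewrite -dvdp_XsubCl (dvdp_trans _ (_ : H^emb %| _)) ?dvdp_XsubCl ?dvdp_map.
rewrite EG root_prod_XsubC => /mapP [i _ Ey].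
have Hx : root H^emb x.
  by move: Hy; rewrite Ey root_frob.
by apply/allP => _ /mapP[j _ ->]; rewrite root_frob.
Qed.

(** By pigeonhole among its conjugates, a root of [P] is fixed by a power of Frobenius; [P] is then
    its minimal polynomial, supplied by [frob_orbit]. *)
Lemma irreducible_roots (P : {poly F}) (x : K) :
  P \is monic -> irreducible_poly P -> root P^emb x ->
  [/\ P^emb = \prod_(y <- [seq x ^+ (q ^ i) | i <- iota 0 (size P).-1]) ('X - y%:P),
    uniq [seq x ^+ (q ^ i) | i <- iota 0 (size P).-1] &
    forall j, (x ^+ (q ^ j) == x) = ((size P).-1 %| j)%N].
Proof.
move=> mP irP Px.
have [n n0 xn] : exists2 n, (0 < n)%N & x ^+ (q ^ n) = x.
  have : ~~ uniq [seq x ^+ (q ^ i) | i <- iota 0 (size P)].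
    apply/negP => u; have : (size [seq x ^+ (q ^ i) | i <- iota 0 (size P)] < size P^emb)%N.
      apply: max_poly_roots => //; first by rewrite map_poly_eq0 monic_neq0.
      by apply/allP => _ /mapP[i _ ->]; rewrite root_frob.
    by rewrite size_map size_iota size_map_poly ltnn.
  move/(uniqPn 0) => [i [j [ij jP]]]; rewrite size_map size_iota in jP.
  rewrite !(nth_map 0%N) ?size_iota ?(ltn_trans ij) // !nth_iota ?(ltn_trans ij) // !add0n => E.
  exists (j - i)%N; first by rewrite subn_gt0.
  by apply: (@frob_card_inj i); rewrite -exprM -expnD subnK // ltnW.
have [G [mG irG EG uG pG]] := frob_orbit n0 xn.
suff /eqP -> : P == G by [].
rewrite -eqp_monic // eqp_sym; case: irP => _; apply;
  first by case: irG => + _; case: (size G) => [|[]].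
by apply: (emb_root_dvdp EG uG); apply/allP => _ /mapP[j _ ->]; rewrite root_frob.
Qed.

(** The list [rs] stands for the field with [q^n] elements inside [K]. The polynomial
    ['X^(q^n) - 'X] has derivative [-1], so its roots are simple. *)
Lemma frob_fixed_points n : (0 < n)%N ->
  exists2 rs : seq K, uniq rs /\ size rs = (q ^ n)%N &
    forall x, (x \in rs) = (x ^+ (q ^ n) == x).
Proof.
move=> n0; have q1 := finNzRing_gt1 F.
have Q1 : (1 < q ^ n)%N by rewrite -(expn0 q) ltn_exp2l.
pose p : {poly K} := 'X^(q ^ n) - 'X.
have sp : size p = (q ^ n).+1 by rewrite size_polyDl ?size_polyXn // size_polyN size_polyX.
have mp : lead_coef p = 1.
  by rewrite lead_coefDl ?lead_coefXn // size_polyN size_polyX size_polyXn.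
have [rs Ers] := closed_field_poly_normal p; rewrite mp scale1r in Ers.
exists rs; last first.
  by move=> x; rewrite -root_prod_XsubC -Ers /root !hornerE subr_eq0.
split; last by move: sp; rewrite Ers size_prod_XsubC => -[].
rewrite -separable_prod_XsubC -Ers unlock.
have -> : p^`() = (-1)%:P.
  rewrite derivB derivXn derivX -mulr_natr natrX.
  have pq : pdiv q \in [pchar K].
    have /andP[_ /allP] := pchar_nat_card 1; apply.
    by rewrite expn1 mem_primes pdiv_prime // pdiv_dvd (ltnW q1).
  have /eqP -> : q%:R == 0 :> {poly K}.
    by rewrite -polyC_natr polyC_eq0 -(dvdn_pcharf pq) pdiv_dvd.
  by rewrite expr0n (gtn_eqF n0) mulr0 sub0r polyCN.
by rewrite -[(-1)%:P]mulr1 mul_polyC coprimepZr ?coprimep1 // oppr_eq0 oner_eq0.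
Qed.

End Frobenius.

(** * Unique factorization and the Euler product *)

Section MonicPolynomials.

Variable F : finFieldType.
Implicit Types (g h P : {poly F}) (n : nat).

Definition polys n : seq {poly F} := [seq rVpoly v | v <- enum 'rV[F]_n].

Lemma mem_polys n g : (g \in polys n) = (size g <= n)%N.
Proof.
apply/mapP/idP => [[v _ ->]|sg]; first exact: size_poly.
by exists (poly_rV g); rewrite ?mem_enum // poly_rV_K.
Qed.

Lemma polys_uniq n : uniq (polys n).
Proof. by rewrite map_inj_uniq ?enum_uniq //; apply: can_inj rVpolyK. Qed.

Definition monics n := [seq g <- polys n.+1 | (g \is monic) && (size g == n.+1)].

Lemma mem_monics n g : (g \in monics n) = (g \is monic) && (size g == n.+1).
Proof. by rewrite mem_filter mem_polys; case: eqP => [->|]; rewrite ?leqnn ?andbT // andbF. Qed.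

Lemma monics_uniq n : uniq (monics n).
Proof. by rewrite filter_uniq ?polys_uniq. Qed.

Definition irred P := (1 < size P)%N &&
  all (fun h => [|| size h == 1%N, ~~ (h %| P) | h %= P]) (polys (size P)).

Lemma irredP P : reflect (irreducible_poly P) (irred P).
Proof.
apply: (iffP andP) => -[sP hP]; split => //.
  move=> h sh hd; have P0 : P != 0 by rewrite -size_poly_gt0 ltnW.
  have := allP hP h; rewrite mem_polys (dvdp_leq P0 hd) (negPf sh) hd => /(_ isT).
  by [].
apply/allP => h _; case: eqVneq => //= sh; case: (boolP (h %| P)) => //= hd.
exact: hP.
Qed.

Definition irrs n := [seq P <- polys n.+1 | (P \is monic) && irred P].

Lemma mem_irrs n P : (P \in irrs n) = [&& P \is monic, irred P & (size P <= n.+1)%N].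
Proof. by rewrite mem_filter mem_polys andbA. Qed.

Lemma irrs_uniq n : uniq (irrs n).
Proof. by rewrite filter_uniq ?polys_uniq. Qed.

Lemma exists_irred_dvdp g : (1 < size g)%N ->
  exists P, [/\ P \is monic, irred P & P %| g].
Proof.
have [n] := ubnP (size g); elim: n g => // n IH g sn sg.
case: (boolP (irred g)) => [ig|].
  have lg : lead_coef g != 0 by rewrite lead_coef_eq0 -size_poly_gt0 ltnW.
  exists ((lead_coef g)^-1 *: g); split.
  - by rewrite monicE lead_coefZ mulVf.
  - apply/irredP; move/irredP: ig => [s1 h1]; split; first by rewrite size_scale ?invr_eq0.
    move=> h sh; rewrite dvdpZr ?invr_eq0 // => /(h1 h sh) e.
    by rewrite (eqp_trans e) // eqp_sym eqp_scale ?invr_eq0.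
  - by rewrite dvdpZl ?invr_eq0.
rewrite /irred sg /= => /allPn [h]; rewrite mem_polys => _.
rewrite !negb_or negbK => /and3P[sh hg nhg].
have g0 : g != 0 by rewrite -size_poly_gt0 ltnW.
have h0 : h != 0 by apply: contraNneq g0 => h0; move: hg; rewrite h0 dvd0p.
have lt : (size h < size g)%N.
  by rewrite ltn_neqAle dvdp_leq // andbT; apply: contra nhg => /eqP e; rewrite -dvdp_size_eqp ?e.
have sh1 : (1 < size h)%N by rewrite ltn_neqAle eq_sym sh size_poly_gt0.
have [P [mP iP Ph]] := IH h (leq_trans lt sn) sh1.
by exists P; split => //; apply: dvdp_trans hg.
Qed.

Lemma irred_dvdp_exp_mul P0 P h e : P0 \is monic -> irred P0 -> P \is monic -> irred P ->
  P != P0 -> (P ^+ e %| P0 * h) = (P ^+ e %| h).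
Proof.
move=> m0 i0 m i ne; apply: Gauss_dvdpr; apply: coprimep_expl.
rewrite /coprimep; apply: contraT => s1.
move/irredP: i0 => [_ /(_ _ s1 (dvdp_gcdr _ _)) e0].
move/irredP: i => [_ /(_ _ s1 (dvdp_gcdl _ _)) e1].
move: ne; rewrite -eqp_monic // (eqp_trans _ e0) //.
by rewrite eqp_sym.
Qed.

Lemma dvdp_exp_degree P h e : h != 0 -> P ^+ e %| h -> (e * (size P).-1 <= (size h).-1)%N.
Proof.
by move=> h0 /(dvdp_leq h0) le; rewrite mulnC -size_exp -!subn1 leq_sub2r.
Qed.

(** The number of [e >= 1] with [P ^+ e %| g] is the multiplicity of [P] in [g], so this is the
    degree count of unique factorization. Removing one irreducible factor [P0] shifts the exponents
    of [P0] by one and leaves those of the other [P] alone. *)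
Lemma sum_degree_irred N n g : g \in monics n -> (n <= N)%N ->
  (\sum_(P <- irrs N) \sum_(1 <= e < N.+1) (P ^+ e %| g)%R * (size P).-1 = n)%N.
Proof.
have [m] := ubnP n; elim: m n g => // m IH n g nm.
rewrite mem_monics => /andP[mg /eqP sg] nN.
have g0 := monic_neq0 mg.
have [n0|n0] := posnP n.
  rewrite n0; rewrite big_seq big1 // => P; rewrite mem_irrs => /and3P[mP /irredP[sP _] _].
  rewrite big_nat big1 // => e /andP[e0 _]; case: (boolP (_ %| _)) => // /(dvdp_exp_degree g0).
  by rewrite sg n0 /= leqn0 muln_eq0; lia.
have [|P0 [m0 i0 dP0]] := @exists_irred_dvdp g; first by rewrite sg.
have [h Eg] := dvdpP _ _ dP0; rewrite mulrC in Eg.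
have s0 : (1 < size P0)%N by case/irredP: i0.
have mh : h \is monic by move: mg; rewrite Eg monicMl.
have h0 := monic_neq0 mh.
pose d0 := (size P0).-1; have Ed0 : size P0 = d0.+1 by rewrite /d0 prednK // ltnW.
have d0_gt0 : (0 < d0)%N by rewrite -ltnS -Ed0.
have sh : (size h + d0 = n.+1)%N.
  by have := size_Mmonic (monic_neq0 m0) mh; rewrite -Eg sg Ed0 addSn /= addnC => ->.
have sh0 : (0 < size h)%N by rewrite size_poly_gt0.
have hn : h \in monics (n - d0).
  by rewrite mem_monics mh /=; move: (size h) sh sh0 => t; clear -d0; move=> *; lia.
have ndm : (n - d0 < m)%N by lia.
have ndN : (n - d0 <= N)%N by lia.
have P0N : P0 \in irrs N by rewrite mem_irrs m0 i0 Ed0 ltnS; lia.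
have := IH _ _ ndm hn ndN.
rewrite !(bigD1_seq P0) ?irrs_uniq //= => IHh.
rewrite [X in (_ + X)%N](_ : _ =
    \sum_(P <- irrs N | P != P0) \sum_(1 <= e < N.+1) (P ^+ e %| h)%R * (size P).-1)%N; last first.
  rewrite big_seq_cond [RHS]big_seq_cond; apply: eq_bigr => P /andP[].
  rewrite mem_irrs => /and3P[mP iP _] ne.
  by apply: eq_bigr => e _; rewrite Eg irred_dvdp_exp_mul.
have N0 : (0 < N)%N by lia.
rewrite (big_ltn (_ : 1 < N.+1)%N) // expr1 dP0 mul1n big_add1 /=.
(* The exponent [N], lost by the shift, contributes nothing since [h] has degree below [N]. *)
have Ee : (\sum_(1 <= e < N.+1) (P0 ^+ e %| h)%R * d0 =
            \sum_(1 <= e < N) (P0 ^+ e.+1 %| g)%R * d0)%N.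
  rewrite big_nat_recr //= (_ : P0 ^+ N %| h = false) ?mul0n ?addn0.
    by apply: eq_bigr => e _; rewrite Eg exprS dvdp_mul2l // monic_neq0.
  apply/negP => /(dvdp_exp_degree h0); rewrite -/d0 => le.
  have := leq_trans (leq_pmulr N d0_gt0) le.
  by move: (size h) sh sh0 => t; clear -d0_gt0 nN; lia.
rewrite -/d0 in IHh *; rewrite -Ee -addnA IHh subnKC //.
by move: (size h) sh sh0 => t; clear; lia.
Qed.

End MonicPolynomials.

Section EulerProduct.

Variables (F : finFieldType) (R : comNzRingType) (lam : {poly F} -> R).
Hypothesis lamM : forall g h, lam (g * h) = lam g * lam h.
Hypothesis lam1 : lam 1 = 1.

(** The coefficient of [T^n] in the L-series of [lam]. *)
Definition monic_sum n : R := \sum_(g <- monics F n) lam g.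

(* N only truncates the sums: for 0 < j <= N the value does not depend on it. *)
Definition prime_power_sum N j : R :=
  \sum_(P <- irrs F N) \sum_(1 <= e < N.+1 | (e * (size P).-1 == j)%N)
    lam P ^+ e *+ (size P).-1.

Lemma lam_exp P e : lam (P ^+ e) = lam P ^+ e.
Proof. by elim: e => [|e IH]; rewrite ?expr0 // !exprS lamM IH. Qed.

Lemma sum_monics_dvdp n P : P \is monic ->
  \sum_(g <- monics F n | P %| g) lam g =
  if ((size P).-1 <= n)%N then lam P * monic_sum (n - (size P).-1) else 0.
Proof.
move=> mP; have P0 := monic_neq0 mP.
have sP : size P = (size P).-1.+1 by rewrite prednK // size_poly_gt0.
case: leqP => le; last first.
  rewrite big_seq_cond big1 // => g /andP[]; rewrite mem_monics => /andP[mg /eqP sg].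
  by move/(dvdp_leq (monic_neq0 mg)); rewrite sg sP ltnS leqNgt le.
rewrite /monic_sum mulr_sumr -big_filter.
rewrite [RHS](eq_bigr (fun g => lam (P * g))); last by move=> g _; rewrite lamM.
rewrite -[RHS](big_map (fun g => P * g) xpredT lam); apply: perm_big; apply: uniq_perm.
- by rewrite filter_uniq ?monics_uniq.
- by rewrite map_inj_uniq ?monics_uniq //; apply: mulfI.
move=> g; rewrite mem_filter mem_monics; apply/idP/mapP => [/and3P[Pg mg /eqP sg]|[h]].
  have [h Eg] := dvdpP _ _ Pg; rewrite mulrC in Eg.
  have mh : h \is monic by move: mg; rewrite Eg monicMl.
  exists h => //; rewrite mem_monics mh.
  have := size_Mmonic P0 mh; rewrite -Eg sg sP /= -subn1.
  have : (0 < size h)%N by rewrite size_poly_gt0 monic_neq0.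
  by move: (size h) (size P).-1 le => s t; clear; lia.
rewrite mem_monics => /andP[mh /eqP sh] ->.
rewrite dvdp_mulIl monicMl // mh size_Mmonic // sh sP /=.
by move: (size P).-1 le => t; clear; lia.
Qed.

(** This is [T L' = (T L' / L) L] for the L-series [L], read off coefficientwise. The factor [n] is
    expanded as the total degree of the prime powers dividing [g], and the sums are exchanged. *)
Lemma monic_sum_recurrence N n : (n <= N)%N ->
  monic_sum n *+ n = \sum_(1 <= j < n.+1) prime_power_sum N j * monic_sum (n - j).
Proof.
move=> nN.
transitivity (\sum_(P <- irrs F N) \sum_(1 <= e < N.+1)
    \sum_(g <- monics F n | P ^+ e %| g) lam g *+ (size P).-1).
  rewrite /monic_sum -sumrMnl [LHS](eq_big_seq (fun g => \sum_(P <- irrs F N) \sum_(1 <= e < N.+1)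
      if P ^+ e %| g then lam g *+ (size P).-1 else 0)) => [|g gn].
    rewrite exchange_big; apply: eq_bigr => P _; rewrite exchange_big.
    by apply: eq_bigr => e _; rewrite [RHS]big_mkcond.
  rewrite -{1}(sum_degree_irred gn nN) -sumrMnr; apply: eq_bigr => P _.
  rewrite -sumrMnr; apply: eq_bigr => e _.
  by case: (_ %| _); rewrite ?mul1n ?mul0n.
rewrite (eq_bigr (fun j => \sum_(P <- irrs F N) \sum_(1 <= e < N.+1)
   if (e * (size P).-1 == j)%N then lam P ^+ e *+ (size P).-1 * monic_sum (n - j) else 0)); last first.
  move=> j _; rewrite mulr_suml; apply: eq_bigr => P _; rewrite mulr_suml big_mkcond.
  by [].
rewrite [RHS]exchange_big; apply: eq_big_seq => P; rewrite mem_irrs => /and3P[mP /irredP[sP _] _].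
rewrite [RHS]exchange_big; apply: eq_big_nat => e /andP[e0 eN].
have sPe : (size (P ^+ e)).-1 = (e * (size P).-1)%N by rewrite size_exp mulnC.
rewrite sumrMnl sum_monics_dvdp ?monic_exp // sPe lam_exp -big_mkcond /=.
have ed : (0 < e * (size P).-1)%N by rewrite muln_gt0 e0 -subn1 subn_gt0.
case: leqP => le; last first.
  rewrite mul0rn big_nat_cond big1 // => j /andP[/andP[_ jn] /eqP Ej].
  by move: le; rewrite Ej ltnNge -ltnS jn.
rewrite (big_rem (e * (size P).-1)%N) /=; last by rewrite mem_index_iota ed ltnS.
rewrite eqxx big_seq_cond big1 ?addr0 ?mulrnAl // => j /andP[].
rewrite mem_rem_uniq ?iota_uniq // !inE => /andP[/eqP ne _] /eqP Ej.
by case: ne.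
Qed.

Lemma prime_power_sumE N j : (0 < j <= N)%N ->
  prime_power_sum N j =
  \sum_(P <- irrs F N | ((size P).-1 %| j)%N) lam P ^+ (j %/ (size P).-1) *+ (size P).-1.
Proof.
move=> /andP[j0 jN]; rewrite /prime_power_sum [RHS]big_mkcond; apply: eq_big_seq => P.
rewrite mem_irrs => /and3P[mP /irredP[sP _] _].
have d0 : (0 < (size P).-1)%N by rewrite -subn1 subn_gt0.
case: ifP => [/dvdnP[a Ej]|nd]; last first.
  by rewrite big1 // => e /eqP Ej; rewrite -Ej dvdn_mull in nd.
rewrite Ej mulnK //.
have aN : a \in index_iota 1 N.+1.
  rewrite mem_index_iota ltnS; apply/andP; split; first by case: (a) Ej j0 => // ->.
  by apply: leq_trans jN; rewrite Ej leq_pmulr.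
rewrite (big_rem a) //= eqxx big_seq_cond big1 ?addr0 // => e /andP[].
rewrite mem_rem_uniq ?iota_uniq // !inE eqn_pmul2r // => /andP[ne _] e2.
by rewrite e2 in ne.
Qed.

End EulerProduct.

(** * Power sums *)

(** Newton's identities: [- T L' / L] is the series of the power sums modulo [T^(N+1)]. In the
    induction on [s], each factor [1 - z T] contributes a geometric series. *)
Lemma newton_generating (R : comNzRingType) (s : seq R) (N : nat) :
  let L := \prod_(z <- s) (1 - z *: 'X) in
  exists Q, L * (\sum_(1 <= n < N.+1) (\sum_(z <- s) z ^+ n) *: 'X^n) + 'X * L^`()
            = 'X^(N.+1) * Q.
Proof.
elim: s => [|z s [Q EQ]] /=.
  exists 0; rewrite big_nil -polyC1 derivC !mulr0 addr0 mul1r big1 // => n _.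
  by rewrite big_nil scale0r.
rewrite big_cons; set L := \prod_(y <- s) _ in EQ *.
pose G := \sum_(1 <= n < N.+1) (\sum_(y <- s) y ^+ n) *: 'X^n : {poly R}.
rewrite -/G in EQ.
have -> : \sum_(1 <= n < N.+1) (\sum_(y <- z :: s) y ^+ n) *: 'X^n =
          \sum_(1 <= n < N.+1) (z *: 'X) ^+ n + G.
  by rewrite /G -big_split; apply: eq_bigr => n _; rewrite big_cons scalerDl exprZn.
have Eg : (1 - z *: 'X) * (\sum_(1 <= n < N.+1) (z *: 'X) ^+ n) = z *: 'X - (z *: 'X) ^+ N.+1.
  rewrite mulr_sumr (eq_bigr (fun n => - ((z *: 'X) ^+ n.+1 - (z *: 'X) ^+ n))); last first.
    by move=> n _; rewrite exprS; ring.
  by rewrite sumrN telescope_sumr // expr1 opprB.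
exists (- (z ^+ N.+1)%:P * L + (1 - z *: 'X) * Q).
rewrite derivM derivB derivZ derivX -polyC1 derivC sub0r polyC1.
transitivity (L * (z *: 'X - (z *: 'X) ^+ N.+1) +
              (1 - z *: 'X) * ('X^(N.+1) * Q) - z *: 'X * L).
  rewrite -Eg -EQ -mul_polyC; move: (\sum_(1 <= n < N.+1) _) => Gz.
  rewrite -!mul_polyC; ring.
rewrite exprZn -!mul_polyC; ring.
Qed.

(** The [a n] are the coefficients of a polynomial with constant term 1, hence of a product of
    factors [1 - z T], with [z] the inverse of a root. By Newton's identities the negated power sums
    solve the recurrence, whose solution is unique as [a 0 = 1]. The list [s] depends on [a] only
    and serves for every [N]. *)
Lemma power_sums_of_recurrence (a : nat -> algC) (k : nat) :
  a 0 = 1 -> (forall n, (k <= n)%N -> a n = 0) ->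
  exists2 s : seq algC, (size s <= k.-1)%N &
    forall (N : nat) (T : nat -> algC),
      (forall n, (n <= N)%N -> a n *+ n = \sum_(1 <= j < n.+1) T j * a (n - j)%N) ->
      forall n, (0 < n <= N)%N -> T n = - \sum_(z <- s) z ^+ n.
Proof.
move=> a0 ak; pose L := \poly_(j < k) a j.
have EL n : L`_n = a n by rewrite coef_poly; case: ltnP => // /ak ->.
have [r Er] := closed_field_poly_normal L.
have L0 : L.[0] = 1 by rewrite horner_coef0 EL.
have nzL : L != 0 by apply: contra_eq_neq L0 => ->; rewrite horner0 eq_sym oner_eq0.
have r0 z : z \in r -> z != 0.
  apply: contraTneq => ->; rewrite -root_prod_XsubC; apply/negP => /eqP h.
  by move/eqP: L0; rewrite Er hornerZ h mulr0 eq_sym oner_eq0.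
pose s := [seq z^-1 | z <- r].
have Es : L = \prod_(z <- s) (1 - z *: 'X).
  have -> : L = (lead_coef L * \prod_(z <- r) (- z)) *: \prod_(z <- s) (1 - z *: 'X).
    rewrite {1}Er -scalerA; congr (_ *: _); rewrite big_map -scaler_prod.
    apply: eq_big_seq => z zr.
    by rewrite scalerBr scalerA mulNr mulfV ?r0 // scaleN1r opprK scaleNr addrC -mul_polyC mulr1.
  have -> : lead_coef L * \prod_(z <- r) (- z) = 1; last by rewrite scale1r.
  transitivity L.[0]; last exact: L0.
  rewrite [L in RHS]Er hornerZ horner_prod; congr (_ * _).
  by apply: eq_bigr => z _; rewrite hornerXsubC sub0r.
exists s.
  have := size_poly k a; rewrite -/L Er size_scale ?lead_coef_eq0 // size_prod_XsubC size_map.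
  by case: k {ak L EL Er L0 nzL Es}.
move=> N T HT; pose t n := \sum_(z <- s) z ^+ n.
have Ht n : (0 < n <= N)%N -> a n *+ n = - \sum_(1 <= j < n.+1) t j * a (n - j)%N.
  move=> /andP[n0 nN]; have [Q] := newton_generating s N; rewrite -Es.
  move/(congr1 (fun p : {poly algC} => p`_n)).
  rewrite coefXnM ltnS nN coefD coefXM -(prednK n0) /= coef_deriv (prednK n0) EL.
  move=> /eqP; rewrite addrC addr_eq0 => /eqP ->; congr (- _).
  rewrite mulrC mulr_suml coef_sum.
  rewrite (@big_cat_nat _ _ _ n.+1) //=.
  rewrite [X in _ + X]big_nat_cond [X in _ + X]big1 ?addr0 => [|j /andP[/andP[nj _] _]].
    apply: eq_big_nat => j /andP[_ jn].
    by rewrite -scalerAl coefZ coefXnM ltnNge -ltnS jn /= EL.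
  by rewrite -scalerAl coefZ coefXnM nj mulr0.
elim/ltn_ind => n IH /andP[n0 nN].
have := HT n nN; rewrite Ht ?n0 //.
rewrite !big_nat_recr //= subnn a0 !mulr1.
rewrite [X in _ = X + _](eq_big_nat _ _ (F2 := fun j => - (t j * a (n - j)%N))).
  by rewrite sumrN opprD => /addrI ->.
move=> j /andP[j0 jn]; rewrite IH ?mulNr // j0 /=.
by apply: leq_trans nN; apply: ltnW.
Qed.

(** If [x > rho], Bernoulli's inequality makes [(x / rho) ^+ l] unbounded, against the bound
    [B / A]. *)
Lemma geometric_growth_bound (rho x A B : algC) (l0 : nat) :
  0 < rho -> 0 <= x -> 0 < A -> 0 <= B ->
  (forall l, (l0 <= l)%N -> A * x ^+ l <= B * rho ^+ l) -> x <= rho.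
Proof.
move=> rho0 x0 A0 B0 H; rewrite (real_leNgt (ger0_real x0) (gtr0_real rho0)); apply/negP => lt.
pose y := x / rho - 1.
have y0 : 0 < y by rewrite subr_gt0 ltr_pdivlMr ?mul1r.
have Ey l : 1 + y *+ l <= (x / rho) ^+ l.
  elim: l => [|l IH]; first by rewrite mulr0n addr0 expr0.
  rewrite exprS; apply: le_trans (_ : (1 + y) * (1 + y *+ l) <= _).
    have -> : (1 + y) * (1 + y *+ l) = 1 + y *+ l.+1 + y * y *+ l by rewrite mulrS; ring.
    by rewrite lerDl mulrn_wge0 // mulr_ge0 // ltW.
  by rewrite addrC subrK; apply: ler_wpM2l; rewrite ?divr_ge0 // ltW.
have bnd l : (l0 <= l)%N -> y *+ l <= B / A.
  move=> /H; rewrite -ler_pdivlMl // => h; apply: le_trans (_ : (x / rho) ^+ l <= _).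
    by apply: le_trans (Ey l); rewrite lerDr ler01.
  rewrite expr_div_n ler_pdivrMr ?exprn_gt0 //; apply: le_trans h _.
  by rewrite mulrA (mulrC A^-1).
have r0 : 0 <= B / A / y by rewrite !divr_ge0 // ltW.
have := archi_boundP r0; set M := Num.bound _.
rewrite ltr_pdivrMr // mulr_natl => ltM.
have leM : y *+ M <= y *+ (M + l0) by rewrite mulrnDr lerDl mulrn_wge0 // ltW.
by have := lt_le_trans ltM (le_trans leM (bnd (M + l0)%N (leq_addl _ _))); rewrite ltxx.
Qed.

(* Combining shifted power sums with the coefficients of a polynomial that
   vanishes at all the other elements of s isolates the powers of z. *)
Lemma power_sum_growth (s : seq algC) (C rho : algC) (l0 : nat) :
  0 < rho -> 0 <= C ->
  (forall l, (l0 <= l)%N -> `|\sum_(z <- s) z ^+ l| <= C * rho ^+ l) ->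
  forall z, z \in s -> `|z| <= rho.
Proof.
move=> rho0 C0 H z zs.
pose P := \prod_(y <- [seq y <- s | y != z]) ('X - y%:P).
have Pz : P.[z] != 0.
  by rewrite -/(root P z) root_prod_XsubC mem_filter eqxx.
(* Equal entries of [s] add up, so [z] enters with a positive multiplicity and cannot cancel. *)
have EP l : \sum_(j < size P) P`_j * (\sum_(y <- s) y ^+ (j + l)) =
            z ^+ l * P.[z] *+ count_mem z s.
  have -> : \sum_(j < size P) P`_j * (\sum_(y <- s) y ^+ (j + l)) = \sum_(y <- s) y ^+ l * P.[y].
    rewrite (eq_bigr (fun j : 'I__ => \sum_(y <- s) P`_j * y ^+ (j + l))); last first.
      by move=> j _; rewrite mulr_sumr.
    rewrite exchange_big; apply: eq_bigr => y _; rewrite horner_coef mulr_sumr.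
    by apply: eq_bigr => j _; rewrite exprD; ring.
  rewrite (bigID (pred1 z)) /= [X in _ + X]big_seq_cond [X in _ + X]big1 ?addr0.
    rewrite (eq_bigr (fun=> z ^+ l * P.[z])); last by move=> y /eqP ->.
    by rewrite big_const_seq iter_addr_0.
  move=> y /andP[ys yz]; apply/eqP; rewrite mulf_eq0; apply/orP; right.
  by rewrite -/(root P y) root_prod_XsubC mem_filter yz.
have c0 : (0 < count_mem z s)%N by rewrite -has_count has_pred1.
pose B := \sum_(j < size P) `|P`_j| * C * rho ^+ j.
apply: (@geometric_growth_bound rho `|z| (`|P.[z]| *+ count_mem z s) B l0) => //.
- by rewrite pmulrn_lgt0 // normr_gt0.
- by apply: sumr_ge0 => j _; rewrite !mulr_ge0 // exprn_ge0 // ltW.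
move=> l ll; have -> : `|P.[z]| *+ count_mem z s * `|z| ^+ l = `|z ^+ l * P.[z] *+ count_mem z s|.
  by rewrite normrMn normrM normrX mulrnAl mulrC.
rewrite -EP; apply: le_trans (ler_norm_sum _ _ _) _; rewrite mulr_suml ler_sum // => j _.
rewrite normrM -!mulrA ler_wpM2l // -exprD; apply: H.
by apply: leq_trans ll (leq_addl _ _).
Qed.

(** * Weil's bound for Kummer sums *)

Section KummerSum.

Variables (F : finFieldType) (K : closedFieldType) (emb : {rmorphism F -> K}).
Variables (g0 : {poly F}) (r0 : seq K) (chi : F -> algC).
Local Notation q := #|F|.
Local Notation "p ^emb" := (map_poly emb p) (at level 2, format "p ^emb").
(** The factor ['X] is kept apart because a simple root in [F] makes it easy to prescribe the value
    of [lam]. The degree of [f] is [k]. *)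
Local Notation f := ('X * g0).
Local Notation rf := (0 :: r0).
Local Notation k := (size g0).

Hypothesis g0_monic : g0 \is monic.
Hypothesis g0_roots : g0^emb = \prod_(x <- r0) ('X - x%:P).
Hypothesis g0_0 : g0.[0] != 0.
Hypothesis chi0 : chi 0 = 0.
Hypothesis chi1 : chi 1 = 1.
Hypothesis chiM : forall a b, chi (a * b) = chi a * chi b.

Lemma f_roots : f^emb = \prod_(x <- rf) ('X - x%:P).
Proof. by rewrite rmorphM /= map_polyX big_cons -g0_roots subr0. Qed.

Lemma f_monic : f \is monic.
Proof. by rewrite monicMl ?monicX. Qed.

Lemma size_f : size f = k.+1.
Proof. by rewrite mulrC size_mulX ?monic_neq0. Qed.

(* Meaningful only for z in the image of F. *)
Definition chiK (z : K) : algC := chi (odflt 0 [pick a | emb a == z]).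

Lemma chiK_emb a : chiK (emb a) = chi a.
Proof.
rewrite /chiK; case: pickP => [b /eqP /(fmorph_inj emb) -> //|/(_ a)].
by rewrite eqxx.
Qed.

(* Up to sign, the resultant of f and g. *)
Definition normf (g : {poly F}) : K := \prod_(x <- rf) g^emb.[x].

(** Frobenius permutes the roots of [f], which has coefficients in [F], and so fixes the product. *)
Lemma normf_in g : exists a, normf g = emb a.
Proof.
apply: frob_fixed; rewrite /normf.
have [phi Ephi] := exists_frob emb 1; rewrite expn1 in Ephi.
have prf : perm_eq [seq x ^+ q | x <- rf] rf.
  apply: prod_XsubC_eq.
  rewrite -f_roots big_map.
  rewrite (eq_bigr (fun x => map_poly phi ('X - x%:P))); last first.
    by move=> x _; rewrite map_polyXsubC /= Ephi.
  rewrite -rmorph_prod /= -f_roots -map_poly_comp; apply: eq_map_poly => a /=.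
  by rewrite Ephi -(expn1 q) emb_fixed.
rewrite -[RHS](perm_big _ prf) big_map -prodrXl; apply: eq_bigr => x _.
by rewrite -{1}(expn1 q) (horner_frob emb 1) expn1.
Qed.

(** A Dirichlet character modulo [f]. *)
Definition lam g := chiK (normf g).

Lemma normfM g h : normf (g * h) = normf g * normf h.
Proof.
by rewrite /normf -big_split; apply: eq_bigr => x _; rewrite rmorphM hornerM.
Qed.

Lemma lamM g h : lam (g * h) = lam g * lam h.
Proof.
rewrite /lam normfM; have [a ->] := normf_in g; have [b ->] := normf_in h.
by rewrite -rmorphM !chiK_emb.
Qed.

Lemma lam1 : lam 1 = 1.
Proof.
rewrite /lam (_ : normf 1 = emb 1) ?chiK_emb // rmorph1 /normf big1 // => x _.
by rewrite rmorph1 hornerE.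
Qed.

Lemma lam_mod g h : f %| (g - h) -> lam g = lam h.
Proof.
move=> /dvdpP [t Et]; rewrite /lam; congr chiK; apply: eq_big_seq => x xr.
apply/eqP; rewrite -subr_eq0 -hornerN -hornerD -rmorphN -rmorphD /= Et rmorphM /= hornerM.
by rewrite f_roots mulf_eq0; apply/orP; right; rewrite -/(root _ _) root_prod_XsubC.
Qed.

(* u is congruent to a modulo 'X and to 1 modulo g0. *)
Lemma exists_lam_unit a : a != 0 -> exists2 u, lam u = chi a & coprimep u f.
Proof.
move=> a0; pose c := (a - 1) / g0.[0]; pose u := 1 + c *: g0.
have u0 : u.[0] = a by rewrite /u /c !hornerE divfK // subrKC.
exists u.
  rewrite -chiK_emb; congr chiK; rewrite /normf big_cons big_seq big1 ?mulr1.
    by rewrite -{1}(rmorph0 emb) horner_map u0.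
  move=> x; rewrite -root_prod_XsubC -g0_roots => /eqP gx.
  by rewrite /u rmorphD rmorph1 /= map_polyZ !hornerE gx mulr0 addr0.
rewrite coprimepMr; apply/andP; split.
  by rewrite -['X]subr0 -polyC0 coprimep_XsubC /root u0.
by rewrite coprimep_sym /u -mul_polyC addrC; rewrite coprimep_addl_mul coprimep1.
Qed.

(* The map G |-> G + ((u - 1) G mod f) permutes the monic polynomials of degree
   n >= k and multiplies lam by chi a. *)
Lemma monic_sum_lam_eq0 n : (exists2 a : F, a != 0 & chi a != 1) -> (k <= n)%N ->
  monic_sum lam n = 0.
Proof.
move=> [a a0 chia] kn; have [u Eu cu] := exists_lam_unit a0.
pose T (g : {poly F}) := g + (u - 1) * g %% f.
have f0 := monic_neq0 f_monic.
have szT (g : {poly F}) : (size ((u - 1) * g %% f)%R < n.+1)%N.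
  by have := ltn_modp ((u - 1) * g) f; rewrite f0 size_f ltnS => /leq_ltn_trans; apply; rewrite ltnS.
have Tmod (g : {poly F}) : f %| (T g - u * g).
  apply/dvdpP; exists (- ((u - 1) * g %/ f)).
  have := divp_eq ((u - 1) * g) f; rewrite /T; move: (_ %/ _) (_ %% _) => d r E.
  have -> : u * g = g + (u - 1) * g by ring.
  by rewrite E; ring.
have Tmon g : g \in monics F n -> T g \in monics F n.
  rewrite !mem_monics => /andP[mg /eqP sg].
  have sT : size (T g) = n.+1 by rewrite size_polyDl sg.
  by rewrite sT eqxx andbT monicE lead_coefDl ?sg //; rewrite -monicE.
(* As [u] is invertible modulo [f], equal images force [g] and [h] to be congruent modulo [f]; the
   corrections added to them then agree. *)
have Tinj : {in monics F n &, injective T}.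
  move=> g h _ _ Egh.
  have : f %| u * (g - h).
    have -> : u * (g - h) = (T h - u * h) - (T g - u * g) by rewrite Egh; ring.
    by rewrite dvdp_sub ?Tmod.
  rewrite Gauss_dvdpr; last by rewrite coprimep_sym.
  move=> fgh; apply/eqP; rewrite -subr_eq0.
  have := congr1 (fun p => p - T h) Egh; rewrite subrr /T.
  rewrite opprD addrACA -modpN -modpD -mulrBr.
  have /modp_eq0P -> : f %| (u - 1) * (g - h) by rewrite dvdp_mull.
  by rewrite addr0 => ->.
have pT : perm_eq [seq T g | g <- monics F n] (monics F n).
  have uT : uniq [seq T g | g <- monics F n] by rewrite map_inj_in_uniq ?monics_uniq.
  apply: uniq_perm => //; first exact: monics_uniq.
  apply: (uniq_min_size uT _ _).2; last by rewrite size_map.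
  by move=> _ /mapP[g gn ->]; apply: Tmon.
have : monic_sum lam n = chi a * monic_sum lam n.
  rewrite {1}/monic_sum -(perm_big _ pT) big_map mulr_sumr; apply: eq_bigr => g _.
  by rewrite -Eu -lamM; apply: lam_mod.
move/eqP; rewrite -subr_eq0 -{1}[monic_sum lam n]mul1r -mulrBl mulf_eq0 subr_eq0.
by rewrite eq_sym (negPf chia) => /eqP.
Qed.

(** The resultant is symmetric up to a sign [(-1)^k] for each conjugate of [x]: the values of [P] at
    the roots of [f] multiply to those of [f] at the conjugates [x^(q^i)], which are [f(x)^(q^i)].
    Running through the orbit [nu / deg P] times yields the norm of [f(x)] from the field with
    [q^nu] elements. *)
Lemma normf_irred_exp P x nu : P \is monic -> irred P -> root P^emb x ->
  ((size P).-1 %| nu)%N ->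
  normf P ^+ (nu %/ (size P).-1) =
  (-1) ^+ (k * nu) * f^emb.[x] ^+ (\sum_(i < nu) q ^ i).
Proof.
move=> mP /irredP iP Px dnu; set d := (size P).-1 in dnu *.
have [EP _ period] := irreducible_roots mP iP Px; rewrite -/d in EP period.
have d0 : (0 < d)%N by case: iP => + _; rewrite /d; case: (size P) => [|[]].
have xd : x ^+ (q ^ d) = x by apply/eqP; rewrite period.
have kr : size rf = k.
  by have := size_prod_XsubC r0 id; rewrite -g0_roots size_map_poly => ->.
pose w := f^emb.[x]; have wd : w ^+ (q ^ d) = w by rewrite /w horner_frob xd.
pose A j := \prod_(i < j) ((-1) ^+ k * w ^+ (q ^ i)).
have EA : normf P = A d.
  rewrite /normf EP (eq_bigr (fun y => \prod_(i < d) (y - x ^+ (q ^ i)))); last first.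
    move=> y _; rewrite big_map horner_prod -{1}(subn0 d) -[iota 0 _]/(index_iota 0 d) big_mkord.
    by apply: eq_bigr => i _; rewrite !hornerE.
  rewrite exchange_big; apply: eq_bigr => i _.
  rewrite /w horner_frob f_roots horner_prod -kr -[(-1) ^+ _]mulr1 -iter_mulr.
  rewrite -(count_predT rf) -big_const_seq -big_split; apply: eq_bigr => y _.
  by rewrite /= !hornerE mulN1r opprB.
have AD j : A (d + j)%N = A d * A j.
  rewrite /A big_split_ord; congr (_ * _); apply: eq_bigr => i _.
  by rewrite /= expnD exprM wd.
have Ad t : A (t * d)%N = A d ^+ t.
  by elim: t => [|t IH]; rewrite ?mul0n ?expr0 /A ?big_ord0 // mulSn -/(A _) AD IH exprS.
rewrite EA -Ad divnK // /A big_split prodr_const card_ord -exprM; congr (_ * _).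
by elim: (nu) => [|j IH]; rewrite ?big_ord0 ?expr0 // !big_ord_recr /= IH exprD.
Qed.

(** Every point of the field with [q^nu] elements is a root of exactly one monic irreducible [P] of
    degree dividing [nu]. Each such [P] has as many roots there as its degree, which is the
    multiplicity in [prime_power_sum]. *)
Lemma sum_fixed_points nu (rs : seq K) : (0 < nu)%N -> uniq rs ->
  (forall x, (x \in rs) = (x ^+ (q ^ nu) == x)) ->
  prime_power_sum lam nu nu =
  \sum_(x <- rs) chiK ((-1) ^+ (k * nu) * f^emb.[x] ^+ (\sum_(i < nu) q ^ i)).
Proof.
move=> nu0 urs mrs; rewrite prime_power_sumE ?nu0 ?leqnn //.
have sumP P : P \in irrs F nu -> ((size P).-1 %| nu)%N ->
    lam P ^+ (nu %/ (size P).-1) *+ (size P).-1 =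
    \sum_(x <- rs | root P^emb x)
      chiK ((-1) ^+ (k * nu) * f^emb.[x] ^+ (\sum_(i < nu) q ^ i)).
  rewrite mem_irrs => /and3P[mP iP _] dnu.
  have [x Px] : exists x, root P^emb x.
    apply/closed_rootP; rewrite size_map_poly.
    by case/irredP: iP => + _; case: (size P) => [|[]].
  rewrite (eq_bigr (fun _ => lam P ^+ (nu %/ (size P).-1))); last first.
    move=> y Py; rewrite -(normf_irred_exp mP iP Py dnu) /lam.
    have [a ->] := normf_in P; rewrite -rmorphXn !chiK_emb.
    by elim: (nu %/ _)%N => [|j IH]; rewrite ?expr0 // !exprS chiM IH.
  rewrite big_const_seq iter_addr_0; congr (_ *+ _).
  have [EP u period] := irreducible_roots mP (irredP _ iP) Px.
  rewrite -size_filter -[LHS](size_iota 0) -(size_map (fun i => x ^+ (q ^ i))).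
  apply/perm_size; apply: uniq_perm => //; first by rewrite filter_uniq.
  move=> y; rewrite -root_prod_XsubC -EP mem_filter.
  case: (boolP (root _ y)) => //= Py; rewrite mrs.
  by have [_ _ ->] := irreducible_roots mP (irredP _ iP) Py.
rewrite big_seq_cond; move: (\sum_(i < nu) q ^ i)%N sumP => E sumP.
under eq_bigr => P /andP[PI dP] do rewrite (sumP P PI dP) big_mkcond.
rewrite -big_seq_cond /= exchange_big; apply: eq_big_seq => x; rewrite mrs => /eqP xnu.
have [G [mG irG EG uG pG]] := frob_orbit emb nu0 xnu.
have Gx : root G^emb x.
  rewrite EG root_prod_XsubC; apply/mapP; exists 0%N; last by rewrite expn0 expr1.
  by rewrite mem_iota /=; case: irG => + _; case: (size G) => [|[]].
have dG : ((size G).-1 %| nu)%N by rewrite -pG xnu eqxx.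
have GI : G \in irrs F nu.
  rewrite mem_irrs mG /=; apply/andP; split; first exact/irredP.
  by rewrite -[size G](prednK (n := size G)) ?size_poly_gt0 ?monic_neq0 // ltnS dvdn_leq.
rewrite -big_mkcondr big_mkcond (big_rem G) //= dG Gx big_seq big1 ?addr0 // => P.
rewrite mem_rem_uniq ?irrs_uniq // => /andP[/eqP ne]; rewrite mem_irrs => /and3P[mP /irredP iP _].
case: ifP => // /andP[_ Px]; case: ne; apply/eqP; rewrite -eqp_monic // eqp_sym.
case: iP => sP; apply; first by case: irG => + _; case: (size G) => [|[]].
apply: (emb_root_dvdp EG uG); apply/allP => _ /mapP[j _ ->].
by rewrite root_frob.
Qed.

(** * Character sums over extensions of even degree *)

Variables (m : nat) (w : algC).
Hypothesis m_gt1 : (1 < m)%N.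
Hypothesis m_dvd : (m %| q.-1)%N.
Hypothesis mk : coprime m k.
Hypothesis w_prim : m.-primitive_root w.
Hypothesis chi_order : forall a, a != 0 -> chi a ^+ m = 1.
(** This turns a prescribed value of [chi] into a polynomial equation, as Stepanov's argument
    requires. *)
Hypothesis chi_classes : forall a b, a != 0 -> b != 0 -> chi a = chi b ->
  a ^+ (q.-1 %/ m) = b ^+ (q.-1 %/ m).

(** The power is the norm of [f(x)] down to [F]: its exponent times [q - 1] is [q^nu - 1], so
    Frobenius fixes it. *)
Lemma norm_emb nu x : (0 < nu)%N -> x ^+ (q ^ nu) = x ->
  exists2 a, f^emb.[x] ^+ (\sum_(i < nu) q ^ i) = emb a & (a == 0) = (f^emb.[x] == 0).
Proof.
move=> nu0 xnu; have yQ : f^emb.[x] ^+ (q ^ nu) = f^emb.[x] by rewrite horner_frob xnu.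
move: (f^emb.[x]) yQ => y yQ; set E := (\sum_(i < nu) q ^ i)%N.
have q1 := finNzRing_gt1 F.
have EQ : (E * q.-1)%N = (q ^ nu).-1 by rewrite predn_exp mulnC.
have E0 : (0 < E)%N.
  rewrite lt0n; apply/eqP => E0; move: EQ; rewrite E0 mul0n => /esym/eqP.
  by rewrite -subn1 subn_eq0 leqNgt -{1}(expn0 q) ltn_exp2l // nu0.
have [a Ea] : exists a, y ^+ E = emb a.
  apply: frob_fixed; have [->|y0] := eqVneq y 0; 
    first by rewrite expr0n (gtn_eqF E0) expr0n (gtn_eqF (ltnW q1)).
  apply: (mulIf y0); rewrite -exprM -[q in LHS](prednK (ltnW q1)) mulnS EQ.
  by rewrite exprD -mulrA -exprSr prednK ?yQ // expn_gt0 (ltnW q1).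
exists a => //; by rewrite -(fmorph_eq0 emb) -Ea expf_eq0 E0.
Qed.

(** Prescribing the character of the norm of [f(x)] fixes the power of [f(x)] with exponent
    [E (q - 1) / m]. With [s = q^l] and [s1 = (s - 1) / m] this exponent is [s1 (s + 1)], so
    [stepanov_bombieri] applies to the field with [s^2] elements. *)
Lemma class_size l (rs : seq K) z : (0 < l)%N ->
  (k * m * (k + 1) < (q ^ l).-1 %/ m)%N -> uniq rs ->
  (forall x, (x \in rs) = (x ^+ (q ^ (l * 2)) == x)) ->
  (size [seq x <- rs | (f^emb.[x] != 0%R) &&
      (chiK (f^emb.[x] ^+ (\sum_(i < l * 2) q ^ i)) == z)] * m <=
   (q ^ l) ^ 2 + m * (2 * k + 1) * (q ^ l))%N.
Proof.
move=> l0 hl urs mrs; set xs := filter _ rs; set E := (\sum_(i < l * 2) q ^ i)%N in xs *.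
have l20 : (0 < l * 2)%N by rewrite muln_gt0 l0.
have m0 : (0 < m)%N by apply: ltnW.
have q1 := finNzRing_gt1 F.
have [xs0|[x0 x0s]] : xs = [::] \/ exists x0, x0 \in xs.
  by case: (xs) => [|x0 xs']; [left|right; exists x0; rewrite mem_head].
  by rewrite xs0 mul0n.
have ml : (m %| (q ^ l).-1)%N by rewrite (dvdn_trans m_dvd) // predn_exp dvdn_mulr.
pose s1 := ((q ^ l).-1 %/ m)%N.
have Es : (q ^ l = m * s1 + 1)%N.
  by rewrite mulnC divnK // addn1 prednK // expn_gt0 (ltnW q1).
have Eexp : (s1 * (q ^ l + 1) = E * (q.-1 %/ m))%N.
  apply/eqP; rewrite -(eqn_pmul2r m0) -[X in _ == X]mulnA divnK // mulnC.
  have -> : (E * q.-1 = (q ^ (l * 2)).-1)%N by rewrite predn_exp mulnC.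
  by rewrite expnM Es; apply/eqP; lia.
have spec x : x \in xs -> exists a,
    [/\ x \in rs, a != 0, f^emb.[x] ^+ E = emb a & chi a = z].
  rewrite mem_filter => /andP[/andP[fx /eqP cx] xr].
  have [|a Ea a0] := @norm_emb (l * 2) x l20; first by apply/eqP; rewrite -mrs.
  by exists a; rewrite a0 -chiK_emb -Ea.
have [a0 [_ a00 _ ca0]] := spec x0 x0s.
apply: (@stepanov_bombieri K f^emb m k (q ^ l)%N s1 (emb (a0 ^+ (q.-1 %/ m))) xs) => //.
- by rewrite size_map_poly size_f.
- by rewrite size_poly_gt0 monic_neq0.
- exact: (pchar_nat_card emb).
- by rewrite fmorph_eq0 expf_neq0.
- by rewrite filter_uniq.
move=> x /spec [a [xr an0 Ea ca]]; split.
  by rewrite -expnM; apply/eqP; rewrite -mrs.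
by rewrite Eexp exprM Ea -rmorphXn /= (chi_classes an0 a00) // ca ca0.
Qed.

(** Each of the [m] value classes has at most [U / m] points and together they cover all but [k]
    points, so none can be much smaller than the others. As the [w ^+ i] sum to 0, only the deficits
    [U / m - N (w ^+ i)] enter the character sum, and their total is [O(q^l)]. *)
Lemma prime_power_sum_bound l : (0 < l)%N ->
  (k * m * (k + 1) < (q ^ l).-1 %/ m)%N ->
  `|prime_power_sum lam (l * 2)%N (l * 2)%N| <= (m * (2 * k + 1) + k)%:R * (q ^ l)%:R.
Proof.
move=> l0 hl; have l20 : (0 < l * 2)%N by rewrite muln_gt0 l0.
have m0 : (0 < m)%N by apply: ltnW.
have [rs [urs srs] mrs] := frob_fixed_points emb l20.
rewrite (sum_fixed_points l20 urs mrs).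
rewrite (eq_bigr (fun x => chiK (f^emb.[x] ^+ (\sum_(i < l * 2) q ^ i)))); last first.
  by move=> x _; rewrite mulnA exprM sqrr_sign mul1r.
set E := (\sum_(i < l * 2) q ^ i)%N.
pose N z := size [seq x <- rs | (f^emb.[x] != 0) && (chiK (f^emb.[x] ^+ E) == z)].
have hN z : (N z * m <= (q ^ l) ^ 2 + m * (2 * k + 1) * (q ^ l))%N by apply: class_size.
set U := ((q ^ l) ^ 2 + m * (2 * k + 1) * (q ^ l))%N in hN.
have cls x : x \in rs -> f^emb.[x] != 0 ->
    exists i : 'I_m, chiK (f^emb.[x] ^+ E) = w ^+ i.
  move=> xr fx; have [|a Ea a0] := @norm_emb (l * 2) x l20; first by apply/eqP; rewrite -mrs.
  have an0 : a != 0 by rewrite a0.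
  by have [i Ei] := prim_rootP w_prim (chi_order an0); exists i; rewrite Ea chiK_emb.
have inj_w (i j : 'I_m) : (w ^+ i == w ^+ j) = (i == j).
  by rewrite (eq_prim_root_expr w_prim) !modn_small.
have Esum (G : algC -> algC) :
    \sum_(x <- rs | f^emb.[x] != 0) G (chiK (f^emb.[x] ^+ E)) = \sum_(i < m) G (w ^+ i) *+ N (w ^+ i).
  rewrite (eq_bigr (fun i : 'I_m => \sum_(x <- rs | f^emb.[x] != 0)
      if chiK (f^emb.[x] ^+ E) == w ^+ i then G (w ^+ i) else 0)) ; last first.
    move=> i _; rewrite -big_mkcondr big_const_seq iter_addr_0; congr (_ *+ _).
    by rewrite /N size_filter; apply: eq_count => x.
  rewrite exchange_big big_seq_cond [RHS]big_seq_cond; apply: eq_bigr => x /andP[xr fx].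
  have [i Ei] := cls x xr fx; rewrite -big_mkcond (big_pred1 i) ?Ei // => j /=.
  by rewrite inj_w eq_sym.
have Echi : \sum_(x <- rs) chiK (f^emb.[x] ^+ E) = \sum_(i < m) w ^+ i *+ N (w ^+ i).
  rewrite -(Esum id) [RHS]big_mkcond; apply: eq_big_seq => x xr.
  have [fx|//] := eqVneq; have [|a Ea a0] := @norm_emb (l * 2) x l20.
    by apply/eqP; rewrite -mrs.
  by rewrite Ea chiK_emb; move: a0; rewrite fx eqxx => /eqP ->.
have EN : (q ^ (l * 2) <= \sum_(i < m) N (w ^+ i)%R + k)%N.
  have /eqP : (count (fun x => f^emb.[x] != 0) rs)%:R = (\sum_(i < m) N (w ^+ i)%R)%:R :> algC.
    by rewrite natr_sum -(Esum (fun=> 1)) big_const_seq iter_addr_0.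
  rewrite eqr_nat => /eqP <-; rewrite -srs -(count_predC (fun x => f^emb.[x] != 0) rs).
  rewrite leq_add2l -size_filter -ltnS -size_f -(size_map_poly emb).
  apply: max_poly_roots; first by rewrite map_poly_eq0 monic_neq0 ?f_monic.
    by apply/allP => x; rewrite mem_filter /= negbK => /andP[].
  by rewrite filter_uniq.
have w_sum : \sum_(i < m) w ^+ i = 0.
  apply/eqP; have /eqP := subrX1 w m; rewrite (prim_expr_order w_prim) subrr eq_sym.
  rewrite mulf_eq0 subr_eq0 -{1}[w]expr1 -(prim_order_dvd w_prim) dvdn1 => /orP[/eqP m1|//].
  by move: m_gt1; rewrite m1.
have w_norm i : `|w ^+ i| = 1.
  rewrite normrX; suff -> : `|w| = 1 by rewrite expr1n.
  apply/eqP; rewrite -(pexpr_eq1 (n := m)) //.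
  by rewrite -normrX (prim_expr_order w_prim) normr1.
set S := \sum_(x <- rs) _ in Echi *.
(* The deficits are multiplied by [m] to stay in the natural numbers; by [hN] the subtraction is not
   truncated. *)
have Sm : `|S| *+ m <= (\sum_(i < m) (U - N (w ^+ i)%R * m))%N%:R.
  have -> : `|S| *+ m = `|\sum_(i < m) w ^+ i *- (U - N (w ^+ i)%R * m)%N|.
    rewrite -normrMn Echi; congr `|_|.
    rewrite [RHS](eq_bigr (fun i : 'I_m => w ^+ i *+ N (w ^+ i) *+ m - w ^+ i *+ U)).
      by rewrite sumrB !sumrMnl w_sum mul0rn subr0.
    by move=> i _; rewrite mulrnBr ?hN // mulrnA opprB.
  apply: le_trans (ler_norm_sum _ _ _) _; rewrite natr_sum ler_sum // => i _.
  by rewrite normrN normrMn w_norm.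
rewrite -(ler_pMn2r m0); apply: le_trans Sm _.
rewrite -natrM -mulrnA ler_nat.
have EU : (\sum_(i < m) (U - N (w ^+ i)%R * m) + (\sum_(i < m) N (w ^+ i)%R) * m = m * U)%N.
  rewrite big_distrl -big_split /= (eq_bigr (fun=> U)); last by move=> i _; rewrite subnK.
  by rewrite big_const_ord iter_addn_0 mulnC.
rewrite expnM in EN; rewrite -(leq_add2r ((\sum_(i < m) N (w ^+ i)%R) * m)) EU /U.
have ks : (k <= k * q ^ l)%N by rewrite leq_pmulr // expn_gt0 (ltnW (finNzRing_gt1 F)).
rewrite -mulnDl mulnC leq_mul2r; apply/orP; right.
move: EN ks; rewrite mulnDl.
move: (_ ^ 2)%N (\sum_(i < m) _)%N (_ * q ^ l)%N (k * q ^ l)%N => A B C D; lia.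
Qed.

(** * The bound over [F] itself *)

Hypothesis chi_nontrivial : exists2 a : F, a != 0 & chi a != 1.

(** At the [k] roots [x] of [f], the polynomial ['X - b] takes the values [x - b], whose product is
    [(-1)^k f(b)]. *)
Lemma monic_sum_lam1 :
  monic_sum lam 1 = chi ((-1) ^+ k) * \sum_(b : F) chi f.[b].
Proof.
have -> : monic_sum lam 1 = \sum_(b : F) lam ('X - b%:P).
  rewrite -(big_map (fun b : F => 'X - b%:P) xpredT lam); apply: perm_big.
  apply: uniq_perm; first exact: monics_uniq.
    rewrite map_inj_uniq ?index_enum_uniq // => a b /(congr1 (fun p => - p.[0])).
    by rewrite !hornerE !opprK.
  move=> g; rewrite mem_monics; apply/idP/mapP => [/andP[mg /eqP sg]|[b _ ->]].
    exists (- g`_0); first exact: mem_index_enum.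
    apply/polyP => i; rewrite coefB coefX coefC.
    move: mg; rewrite monicE lead_coefE sg /= => /eqP g1.
    case: i => [|[|i]] //=; rewrite ?sub0r ?opprK ?subr0 //.
    by rewrite oppr0 nth_default // sg.
  by rewrite monicXsubC size_XsubC.
rewrite mulr_sumr; apply: eq_bigr => b _; rewrite -chiM -chiK_emb /lam; congr chiK.
rewrite rmorphM rmorphXn rmorphN1 /= -horner_map f_roots horner_prod /=.
have kr : size rf = k.
  by have := size_prod_XsubC r0 id; rewrite -g0_roots size_map_poly => ->.
rewrite -kr -[(-1) ^+ _]mulr1 -iter_mulr.
rewrite -(count_predT rf) -big_const_seq -big_split; apply: eq_bigr => y _.
by rewrite /= map_polyXsubC !hornerE mulN1r opprB.
Qed.

(** The L-series is a polynomial of degree below [k], so its coefficient of [T] is minus the sum of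
    at most [k - 1] inverse roots, each of absolute value at most the square root of [q]. *)
Lemma kummer_sum_bound :
  `|\sum_(b : F) chi f.[b]| <= k.-1%:R * sqrtC q%:R.
Proof.
have m0 : (0 < m)%N by apply: ltnW.
have q0 : (0 < q)%N := ltnW (finNzRing_gt1 F).
have a0 : monic_sum lam 0 = 1.
  rewrite /monic_sum (perm_big [:: 1]) ?big_seq1 ?lam1 //.
  apply: uniq_perm => //; first exact: monics_uniq.
  move=> g; rewrite mem_monics inE; apply/andP/eqP => [[mg sg]|->].
    by apply/eqP; rewrite -eqp_monic ?monic1 // -size_poly_eq1.
  by rewrite monic1 size_poly1.
have [s ss Hs] := power_sums_of_recurrence a0
  (fun n => @monic_sum_lam_eq0 n chi_nontrivial).
have HT N n : (0 < n <= N)%N -> prime_power_sum lam N n = - \sum_(z <- s) z ^+ n.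
  by apply: Hs => n' n'N; apply: monic_sum_recurrence => //; [exact: lamM | exact: lam1].
have s_bound z : z \in s -> `|z| <= sqrtC q%:R.
  (* Only power sums of even order are under control, so the growth argument is applied to the
     squares of the entries, with rate [q]. *)
  move=> zs; rewrite -(ler_pXn2r (n := 2)) ?nnegrE ?sqrtC_ge0 ?ler0n // sqrtCK -normrX.
  (* From [l0] on, [q^l > l] makes [(q^l - 1) / m] exceed the threshold of Stepanov's argument. *)
  pose l0 := (m * (k * m * (k + 1)).+1)%N.
  apply: (@power_sum_growth [seq y ^+ 2 | y <- s] (m * (2 * k + 1) + k)%:R q%:R l0).
  - by rewrite ltr0n.
  - exact: ler0n.
  - move=> l ll; have l_gt0 : (0 < l)%N by apply: leq_trans ll; rewrite muln_gt0 m0.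
    have hl : (k * m * (k + 1) < (q ^ l).-1 %/ m)%N.
      rewrite leq_divRL // mulnC; apply: leq_trans ll _.
      by rewrite -ltnS prednK ?expn_gt0 ?q0 // ltn_expl // finNzRing_gt1.
    have := prime_power_sum_bound l_gt0 hl.
    rewrite HT ?muln_gt0 ?l_gt0 ?leqnn // normrN natrX big_map.
    rewrite (eq_bigr (fun y => (y ^+ 2) ^+ l)) // => y _.
    by rewrite mulnC exprM.
  - by apply/mapP; exists z.
have := monic_sum_recurrence (lam := lam) lamM lam1 (leqnn 1).
rewrite mulr1n big_nat1 subnn a0 mulr1 HT // => Ea1.
have chi_sign : `|chi ((-1) ^+ k)| = 1.
  apply/eqP; rewrite -(pexpr_eq1 (n := m)) //.
  by rewrite -normrX chi_order ?normr1 // expf_neq0 // oppr_eq0 oner_eq0.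
have -> : `|\sum_(b : F) chi f.[b]| = `|\sum_(z <- s) z ^+ 1|.
  by rewrite -[RHS]normrN -Ea1 monic_sum_lam1 normrM chi_sign mul1r.
apply: le_trans (ler_norm_sum _ _ _) _.
apply: le_trans (_ : (size s)%:R * sqrtC q%:R <= _).
  rewrite mulr_natl -[size s]count_predT -iter_addr_0 -big_const_seq.
  by rewrite big_seq_cond [X in _ <= X]big_seq_cond ler_sum // => z /andP[/s_bound].
by rewrite ler_wpM2r ?sqrtC_ge0 ?ler0n // ler_nat.
Qed.

End KummerSum.

(** * Multiplicative characters and Kummer equations *)

Section Characters.

Variables (F : finFieldType) (g : F).
Local Notation q := #|F|.
Hypothesis g_prim : q.-1.-primitive_root g.

Lemma expf_card_pred (a : F) : a != 0 -> a ^+ q.-1 = 1.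
Proof.
move=> a0; apply: (mulfI a0).
by rewrite -exprS prednK ?(ltnW (finNzRing_gt1 F)) // expf_card mulr1.
Qed.

Definition dlog (a : F) : nat :=
  if [pick i : 'I_q.-1 | a == g ^+ i] is Some i then i else 0.

Lemma dlogK a : a != 0 -> g ^+ dlog a = a.
Proof.
move=> a0; rewrite /dlog; case: pickP => [i /eqP -> //|no].
by have [i Ei] := prim_rootP g_prim (expf_card_pred a0); have := no i; rewrite Ei eqxx.
Qed.

(** When the order of [w] divides [q - 1], this is the multiplicative character sending [g] to [w];
    even the trivial one is made to vanish at 0. *)
Definition mul_char (w : algC) (a : F) : algC := if a == 0 then 0 else w ^+ dlog a.

Lemma g_neq0 : g != 0.
Proof.
have q1 : (0 < q.-1)%N by rewrite -subn1 subn_gt0 finNzRing_gt1.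
by apply/eqP => E; have /eqP := prim_expr_order g_prim; rewrite E expr0n gtn_eqF // eq_sym oner_eq0.
Qed.

Lemma mul_char_expg (m : nat) w (i : nat) :
  (m %| q.-1)%N -> m.-primitive_root w -> mul_char w (g ^+ i) = w ^+ i.
Proof.
move=> mq mw; rewrite /mul_char expf_eq0 (negPf g_neq0) andbF.
apply/eqP; rewrite (eq_prim_root_expr mw) -(modn_dvdm (m := q.-1) _ mq).
rewrite -[X in _ == X](modn_dvdm (m := q.-1) _ mq); apply/eqP; congr modn; apply/eqP.
by rewrite -(eq_prim_root_expr g_prim) dlogK // expf_neq0 // g_neq0.
Qed.

Lemma mul_char0 w : mul_char w 0 = 0.
Proof. by rewrite /mul_char eqxx. Qed.

Lemma mul_charM m w : (m %| q.-1)%N -> m.-primitive_root w ->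
  forall a b, mul_char w (a * b) = mul_char w a * mul_char w b.
Proof.
move=> mq mw a b; have [->|a0] := eqVneq a 0; first by rewrite mul0r mul_char0 mul0r.
have [->|b0] := eqVneq b 0; first by rewrite mulr0 mul_char0 mulr0.
by rewrite -[a]dlogK // -[b]dlogK // -exprD !(mul_char_expg _ mq mw) exprD.
Qed.

Lemma mul_char1 m w : (m %| q.-1)%N -> m.-primitive_root w -> mul_char w 1 = 1.
Proof. by move=> mq mw; rewrite -(expr0 g) (mul_char_expg _ mq mw). Qed.

Lemma mul_char_order m w a : (m %| q.-1)%N -> m.-primitive_root w -> a != 0 ->
  mul_char w a ^+ m = 1.
Proof.
move=> mq mw a0; rewrite -[a]dlogK // (mul_char_expg _ mq mw) exprAC.
by rewrite (prim_expr_order mw) expr1n.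
Qed.

Lemma mul_char_classes m w : (m %| q.-1)%N -> m.-primitive_root w ->
  forall a b, a != 0 -> b != 0 -> mul_char w a = mul_char w b ->
  a ^+ (q.-1 %/ m) = b ^+ (q.-1 %/ m).
Proof.
move=> mq mw a b a0 b0; rewrite -[a]dlogK // -[b]dlogK // !(mul_char_expg _ mq mw) => /eqP.
rewrite (eq_prim_root_expr mw) => /eqP E; rewrite -!exprM; apply/eqP.
rewrite (eq_prim_root_expr g_prim) (divn_eq (dlog a) m) (divn_eq (dlog b) m) E !mulnDl.
by rewrite -!mulnA ![(m * _)%N]mulnC divnK // !modnMDl.
Qed.

Lemma mul_char_sum_bound (g0 : {poly F}) m w :
  (1 < m)%N -> (m %| q.-1)%N -> m.-primitive_root w ->
  g0 \is monic -> g0.[0] != 0 -> coprime m (size g0) ->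
  `|\sum_(b : F) mul_char w ('X * g0).[b]| <= (size g0).-1%:R * sqrtC q%:R.
Proof.
move=> m1 mq mw g0m g00 cop.
have [K [/= emb _]] := countable_algebraic_closure F.
have [r0 Er0] := closed_field_poly_normal (map_poly emb g0).
rewrite lead_coef_map (monicP g0m) rmorph1 scale1r in Er0.
apply: (@kummer_sum_bound F K emb g0 r0 (mul_char w) _ _ _ _ _ _ m w) => //.
- exact: mul_char0.
- exact: mul_char1 mq mw.
- exact: mul_charM mq mw.
- by move=> a a0; apply: mul_char_order mq mw a0.
- exact: mul_char_classes mq mw.
exists g; first exact: g_neq0.
rewrite -[g]expr1 (mul_char_expg _ mq mw) expr1 -(expr1 w) -(prim_order_dvd mw) dvdn1.
by case: (m) m1 => [|[]].
Qed.

(** Orthogonality: the sum is geometric with ratio [W ^+ dlog y], an [M]-th root of unity. *)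
Lemma sum_mul_char (M : nat) (W : algC) y : (0 < M)%N -> M.-primitive_root W -> y != 0 ->
  \sum_(j < M) mul_char (W ^+ j) y = ((M %| dlog y)%N * M)%:R.
Proof.
move=> M0 Wp y0; rewrite (eq_bigr (fun j : 'I_M => (W ^+ dlog y) ^+ j)); last first.
  by move=> j _; rewrite /mul_char (negPf y0) exprAC.
case: (boolP (M %| _)%N) => [My|nMy].
  rewrite (eq_bigr (fun=> 1)); last first.
    by move=> j _; rewrite (eqP (_ : W ^+ dlog y == 1)) ?expr1n // -(prim_order_dvd Wp).
  by rewrite sumr_const card_ord mul1n.
rewrite mul0n; apply/eqP; have /eqP := subrX1 (W ^+ dlog y) M.
rewrite exprAC (prim_expr_order Wp) expr1n subrr eq_sym mulf_eq0 subr_eq0.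
by rewrite -(prim_order_dvd Wp) (negPf nMy).
Qed.

(** If the gcd [M] divides [dlog y], Bezout's identity gives one root, and its products with the
    powers of [g ^+ (q.-1 %/ M)] give [M] of them. *)
Lemma card_nth_roots n y : (0 < n)%N -> y != 0 ->
  (((gcdn n q.-1 %| dlog y) * gcdn n q.-1)%N <= #|[set z : F | (z != 0%R) && (z ^+ n == y)]|)%N.
Proof.
move=> n0 y0; set M := gcdn n q.-1; case: (boolP (M %| _)%N) => //; rewrite mul1n.
have q10 : (0 < q.-1)%N by rewrite -subn1 subn_gt0 finNzRing_gt1.
move=> /dvdnP[t Et]; have M0 : (0 < M)%N by rewrite gcdn_gt0 n0.
have [a Ea] : exists a, (g ^+ a) ^+ n = y.
  have [u v Euv _] := egcdnP q.-1 n0; exists (u * t)%N.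
  rewrite -exprM -[RHS](dlogK y0) Et; apply/eqP; rewrite (eq_prim_root_expr g_prim).
  have -> : (u * t * n = t * (u * n))%N by ring.
  by rewrite Euv mulnDr mulnA modnMDl.
have Mq : (M %| q.-1)%N := dvdn_gcdr _ _; have Mn : (M %| n)%N := dvdn_gcdl _ _.
clearbody M; have qM0 : (0 < q.-1 %/ M)%N by rewrite divn_gt0 // dvdn_leq.
pose z (i : 'I_M) := g ^+ (a + q.-1 %/ M * i).
have zinj : injective z.
  move=> i j /eqP; rewrite (eq_prim_root_expr g_prim) eqn_modDl.
  rewrite !modn_small; last 2 first.
  - by rewrite -{2}(divnK Mq) ltn_pmul2l.
  - by rewrite -{2}(divnK Mq) ltn_pmul2l.
  by rewrite eqn_pmul2l // => /eqP /val_inj.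
rewrite -[M]card_ord -(card_imset _ zinj); apply: subset_leq_card; apply/subsetP => _ /imsetP[i _ ->].
rewrite inE expf_neq0 ?g_neq0 //= /z exprD exprMn Ea -exprM.
have -> : (q.-1 %/ M * i * n = q.-1 * (i * (n %/ M)))%N.
  by rewrite -{1}(divnK Mn) -{2}(divnK Mq); ring.
by rewrite exprM (prim_expr_order g_prim) expr1n mulr1.
Qed.

(** Orthogonality bounds the number of solutions from below by a sum over the characters of order
    dividing [M]. The trivial one counts the [t] with [h(t) != 0], at least [q - size g0] of them;
    each of the other [M - 1] obeys Weil's bound. *)
Lemma kummer_count (g0 : {poly F}) n d :
  let M := gcdn n q.-1 in
  (0 < n)%N -> d != 0 -> g0 \is monic -> g0.[0] != 0 -> coprime M (size g0) ->
  q%:R <= (#|[set zt : F * F | (zt.1 != 0) && (zt.1 ^+ n * d == ('X * g0).[zt.2])]|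
             + size g0)%:R + (M.-1 * (size g0).-1)%:R * sqrtC q%:R :> algC.
Proof.
move=> M n0 d0 g0m g00 cop; set h := 'X * g0; set A := [set zt | _].
have M0 : (0 < M)%N by rewrite gcdn_gt0 n0.
have Mq : (M %| q.-1)%N := dvdn_gcdr _ _.
have [W Wp] := C_prim_root_exists M0.
pose T := (\sum_(t : F | h.[t] != 0%R) (M %| dlog (h.[t] / d)%R) * M)%N.
have TA : (T <= #|A|)%N.
  rewrite -sum1dep_card (partition_big (fun zt : F * F => zt.2) (fun t => h.[t] != 0)) /=.
    apply: leq_sum => t ht; apply: leq_trans (card_nth_roots n0 (_ : h.[t] / d != 0)) _.
      by rewrite mulf_neq0 ?invr_neq0.
    rewrite sum1dep_card -(card_imset _ (_ : injective (fun z : F => (z, t)))); last by move=> z z' [].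
    apply: subset_leq_card; apply/subsetP => zt /imsetP[z]; rewrite inE => /andP[z0 /eqP zn] ->.
    by rewrite inE /= z0 zn divfK // !eqxx.
  by move=> [z t] /andP[/= z0 /eqP <-]; rewrite mulf_neq0 // expf_neq0.
pose Z := #|[set t : F | h.[t] != 0]|.
have qZ : (q <= Z + size g0)%N.
  rewrite -(cardsC [set t : F | h.[t] != 0]) leq_add2l.
  have h0 : h != 0 by rewrite mulf_neq0 ?polyX_eq0 ?monic_neq0.
  have sh : size h = (size g0).+1 by rewrite /h mulrC size_mulX ?monic_neq0.
  rewrite -ltnS -sh cardE; apply: max_poly_roots => //; last exact: enum_uniq.
  by apply/allP => t; rewrite mem_enum !inE negbK.
have ET : T%:R = \sum_(j < M) \sum_(t : F) mul_char (W ^+ j) (h.[t] / d) :> algC.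
  rewrite exchange_big /T natr_sum big_mkcond; apply: eq_bigr => t _.
  have [ht|ht] := eqVneq; last by rewrite (sum_mul_char M0 Wp) // mulf_neq0 ?invr_neq0.
  by rewrite ht mul0r big1 // => j _; rewrite mul_char0.
have E0 : \sum_(t : F) mul_char (W ^+ 0) (h.[t] / d) = Z%:R.
  rewrite /Z -sum1dep_card natr_sum [RHS]big_mkcond; apply: eq_bigr => t _.
  rewrite /mul_char mulf_eq0 invr_eq0 (negPf d0) orbF expr0 expr1n.
  by case: eqP.
have Ej (j : 'I_M) : (0 < j)%N ->
    `|\sum_(t : F) mul_char (W ^+ j) (h.[t] / d)| <= (size g0).-1%:R * sqrtC q%:R.
  (* The exact order [m] of [W ^+ j] divides [M], hence is still coprime to the degree of [h]. *)
  move=> j0; pose m := (M %/ gcdn j M)%N.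
  have mp : m.-primitive_root (W ^+ j) := exp_prim_root Wp j.
  have gM : (gcdn j M %| M)%N := dvdn_gcdr _ _.
  have mM : (m %| M)%N by apply/dvdnP; exists (gcdn j M); rewrite mulnC divnK.
  have mq : (m %| q.-1)%N := dvdn_trans mM Mq.
  have m1 : (1 < m)%N.
    rewrite ltn_divRL // mul1n; apply: leq_ltn_trans (ltn_ord j).
    by apply: dvdn_leq (dvdn_gcdl _ _).
  rewrite (eq_bigr (fun t => mul_char (W ^+ j) d^-1 * mul_char (W ^+ j) h.[t])); last first.
    by move=> t _; rewrite (mul_charM mq mp) mulrC.
  rewrite -mulr_sumr normrM.
  have -> : `|mul_char (W ^+ j) d^-1| = 1.
    apply/eqP; rewrite -(pexpr_eq1 (n := m)) // 1?ltnW //.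
    by rewrite -normrX (mul_char_order mq mp) ?normr1 // invr_eq0.
  rewrite mul1r; apply: mul_char_sum_bound mq mp g0m g00 _ => //.
  exact: coprime_dvdl mM cop.
have EM : (\sum_(j < M | (0 < j)%N) 1 = M.-1)%N.
  case: (M) M0 => // M' _; rewrite big_mkcond big_ord_recl /= add0n.
  by rewrite sum_nat_const card_ord muln1.
have diff : Z%:R - T%:R <= (M.-1 * (size g0).-1)%:R * sqrtC q%:R :> algC.
  apply: le_trans (real_ler_norm _) _; first by rewrite rpredB ?realn.
  rewrite distrC ET (bigD1 (Ordinal M0)) //= E0 addrAC subrr add0r.
  apply: le_trans (ler_norm_sum _ _ _) _.
  apply: le_trans (_ : \sum_(j < M | (0 < j)%N) (size g0).-1%:R * sqrtC q%:R <= _).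
    rewrite (eq_bigl (fun j : 'I_M => (0 < j)%N)); first by apply: ler_sum => j /Ej.
    by move=> j; rewrite lt0n -val_eqE.
  by rewrite sumr_const -sum1_card EM natrM -mulrA [X in _ <= X]mulr_natl lexx.
have h1 : q%:R <= (Z + size g0)%:R :> algC by rewrite ler_nat.
apply: le_trans h1 _; rewrite !natrD addrAC lerD2r.
move: diff; rewrite lerBlDl => /le_trans; apply.
by rewrite lerD2r ler_nat.
Qed.

End Characters.

(** * Carlitz representations and collisions *)

(** For [y = 0] both sides are 0, because the exponent is positive and [0^-1 = 0]. *)
Lemma expf_card_minus2 (F : finFieldType) (y : F) : (2 < #|F|)%N -> y ^+ (#|F| - 2) = y^-1.
Proof.
move=> q3; have [->|y0] := eqVneq y 0; first by rewrite expr0n subn_eq0 leqNgt q3 invr0.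
apply: (mulfI y0); rewrite mulfV //; apply: (mulfI y0).
by rewrite -!exprS mulr1 -addn2 subnK ?expf_card // ltnW.
Qed.

(** The determinant of consecutive convergents of a continued fraction. For [a 0 != 0] it prevents
    [alpha] and [beta] from vanishing at the same index. *)
Lemma alpha_beta_det (F : finFieldType) (a : nat -> F) j :
  alpha a j.+1 * beta a j - alpha a j * beta a j.+1 = (-1) ^+ j * a 0.
Proof.
elim: j => [|j IH]; first by rewrite /= expr0; ring.
rewrite [alpha a j.+2]/= [beta a j.+2]/= -/(alpha a j.+1) -/(beta a j.+1).
by rewrite exprS -mulrA -IH /=; ring.
Qed.

(** Away from the poles every application of the power map inverts a nonzero element, so the nested
    expression follows the recurrence of [alpha] and [beta]. *)
Lemma carlitz_outside_poles (F : finFieldType) (a : nat -> F) (n : nat) (x : F) :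
  (2 < #|F|)%N ->
  (forall j, (0 < j <= n)%N -> alpha a j * x + beta a j != 0) ->
  forall j, (j <= n)%N ->
  (carlitz_poly a j).[x] =
    (alpha a j.+1 * x + beta a j.+1) / (alpha a j * x + beta a j).
Proof.
move=> q3 hx; elim=> [|j IH] jn.
  by rewrite /= !hornerE divr1.
have u0 := hx j.+1 jn.
have v0 : alpha a j * x + beta a j != 0.
  case: (j) jn => [|j'] jn'; first by rewrite /= mul0r add0r oner_eq0.
  by apply: hx; apply: (ltnW jn').
rewrite [carlitz_poly _ _]/= hornerD hornerC horner_exp IH 1?ltnW //.
rewrite expf_card_minus2 // invf_div.
rewrite [alpha a j.+2]/= [beta a j.+2]/= -/(alpha a j.+1) -/(beta a j.+1).
by field.
Qed.

(** [E] consists of the finite poles. As the last one is 0, [beta a n = 0] and the fractional linear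
    map reduces to [A + B / x]; the determinant identity gives [B != 0]. *)
Lemma carlitz_form (F : finFieldType) (a : nat -> F) (n : nat) :
  (2 < #|F|)%N -> a 0 != 0 -> (0 < n)%N -> alpha a n != 0 -> pole a n = 0 ->
  exists E : {set F}, exists A B, [/\ B != 0, (#|E| <= n)%N, 0 \in E &
    forall x, x \notin E -> (carlitz_poly a n).[x] = A + B / x].
Proof.
move=> q3 a0 n0 an /eqP; rewrite oppr_eq0 mulf_eq0 invr_eq0 (negPf an) orbF => /eqP bn.
exists [set x | [exists j : 'I_n, alpha a j.+1 * x + beta a j.+1 == 0]].
exists (alpha a n.+1 / alpha a n), (beta a n.+1 / alpha a n).
have bn1 : beta a n.+1 != 0.
  apply/eqP => E; have /esym/eqP := alpha_beta_det a n.
  by rewrite E bn !mulr0 subrr mulf_eq0 expf_eq0 oppr_eq0 oner_eq0 andbF (negPf a0).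
have En : (n.-1 < n)%N by rewrite prednK.
split.
- by rewrite mulf_neq0 ?invr_neq0.
- apply: (@leq_trans #|[set pole a (nat_of_ord j).+1 | j : 'I_n]|); last first.
    by apply: leq_trans (leq_imset_card _ _) _; rewrite card_ord.
  apply: subset_leq_card; apply/subsetP => x; rewrite inE => /existsP[j /eqP xj].
  apply/imsetP; exists j => //; rewrite /pole.
  have aj : alpha a j.+1 != 0.
    apply/eqP => E; have /esym/eqP := alpha_beta_det a j; move: xj.
    rewrite E !mul0r add0r => ->.
    by rewrite !mulr0 subrr mulf_eq0 expf_eq0 oppr_eq0 oner_eq0 andbF (negPf a0).
  by apply: (mulfI aj); rewrite mulrN mulrCA divff // mulr1; apply/eqP; rewrite -addr_eq0 xj.
- rewrite inE; apply/existsP; exists (Ordinal En).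
  by rewrite [nat_of_ord _]/= prednK // mulr0 add0r bn.
move=> x; rewrite inE negb_exists => /forallP hx.
have hx' j : (0 < j <= n)%N -> alpha a j * x + beta a j != 0.
  by case: j => // j jn; apply: (hx (Ordinal jn)).
have x0 : x != 0.
  by apply: contraTneq (hx' n _) => [->|]; rewrite ?n0 ?leqnn // mulr0 bn addr0 eqxx.
rewrite (carlitz_outside_poles q3 hx') // bn addr0.
by field; rewrite x0.
Qed.

(** A collision involves a point of [E] other than 0. A first coordinate of that kind has at most
    [k] partners, the other roots of a polynomial of degree [k + 1]. Otherwise the second coordinate
    is of that kind and determines the first by injectivity. *)
Lemma collision_bound (F : finFieldType) (E : {set F}) (n k : nat) (B c : F) :
  c != 0 -> B != 0 -> (0 < k)%N -> (#|E| <= n)%N -> 0 \in E ->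
  {in ~: E &, injective (fun x : F => B / x + c * x ^+ k)} ->
  (#|[set xy : F * F | [&& xy.1 != 0%R, xy.2 != 0%R, xy.1 != xy.2 &
      (B / xy.1 + c * xy.1 ^+ k == B / xy.2 + c * xy.2 ^+ k)%R]]| <= n.-1 * k.+1)%N.
Proof.
move=> c0 B0 k0 En E0 inj; set C := [set xy | _].
pose g x := B / x + c * x ^+ k.
pose E' := E :\ 0; have E'n : (#|E'| <= n.-1)%N.
  by move: En; rewrite (cardsD1 0 E) E0 add1n; case: n.
have C1 : (#|[set xy in C | xy.1 \in E']| <= #|E'| * k)%N.
  rewrite -sum1dep_card (partition_big (fun xy : F * F => xy.1) (mem E')) /=; last first.
    by move=> xy /andP[].
  rewrite -sum_nat_const; apply: leq_sum => x xE.
  have x0 : x != 0 by move: xE; rewrite !inE => /andP[].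
  (* At [y != 0] the value of [p] is [y * (g y - g x)]. *)
  pose p : {poly F} := c *: 'X^(k.+1) + (B%:P - g x *: 'X).
  have sp : size p = k.+2.
    rewrite size_polyDl size_scale ?size_polyXn //.
    apply: leq_ltn_trans (size_polyD _ _) _; rewrite gtn_max size_polyN.
    apply/andP; split; first exact: leq_ltn_trans (size_polyC_leq1 _) _.
    by apply: leq_ltn_trans (size_scale_leq _ _) _; rewrite size_polyX.
  have p0 : p != 0 by rewrite -size_poly_gt0 sp.
  have rootp y : y != 0 -> g y = g x -> root p y.
    move=> y0 gy; rewrite /root /p -gy /g !hornerE /= ?exprS; apply/eqP.
    by field.
  pose Y := [set y : F | [&& y != 0, x != y & g x == g y]].
  apply: (@leq_trans #|Y|).
    rewrite sum1dep_card -(card_imset _ (_ : injective (fun y : F => (x, y)))); last first.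
      by move=> y y' [].
    apply: subset_leq_card; apply/subsetP => -[x' y]; rewrite !inE /=.
    move=> /andP[/andP[/and4P[_ y0 xy gxy] _] /eqP Ex]; subst x'.
    by apply/imsetP; exists y; rewrite // inE y0 xy gxy.
  have : (size (x :: enum Y) < size p)%N.
    apply: max_poly_roots => //.
      apply/andP; split; first exact: rootp.
      by apply/allP => y; rewrite mem_enum inE => /and3P[y0 _ /eqP gxy]; apply: rootp.
    by rewrite /= enum_uniq mem_enum inE eqxx andbF.
  by rewrite sp /= -cardE !ltnS.
have C2 : (#|[set xy in C | xy.1 \notin E']| <= #|E'|)%N.
  have C2E xy : xy \in [set xy in C | xy.1 \notin E'] ->
      [/\ xy.1 \in ~: E, xy.2 \in E', xy.1 != xy.2 & g xy.1 = g xy.2].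
    rewrite !inE => /andP[/and4P[x0 y0 xy12 /eqP gxy]]; rewrite x0 y0 /= => xE.
    split => //; apply: contraT => yE; case/eqP: xy12.
    by apply: inj gxy; rewrite inE.
  rewrite -(card_in_imset (f := fun xy : F * F => xy.2)).
    by apply: subset_leq_card; apply/subsetP => y /imsetP[xy /C2E[_ yE _ _] ->].
  move=> [x y] [x' y'] /C2E[/= xE yE _ gx] /C2E[/= xE' _ _ gx'] /= Ey.
  by subst y'; congr pair; apply: inj => //; rewrite -/(g x) -/(g x') gx gx'.
rewrite -(cardsID [set xy : F * F | xy.1 \in E'] C).
have -> : C :&: [set xy : F * F | xy.1 \in E'] = [set xy in C | xy.1 \in E'].
  by apply/setP => xy; rewrite !inE.
have -> : C :\: [set xy : F * F | xy.1 \in E'] = [set xy in C | xy.1 \notin E'].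
  by apply/setP => xy; rewrite !inE andbC.
apply: leq_trans (leq_add C1 C2) _; rewrite -mulnSr leq_mul2r E'n orbT //.
Qed.

Lemma exists_prim_root_card (F : finFieldType) :
  exists g : F, #|F|.-1.-primitive_root g.
Proof.
have q10 : (0 < #|F|.-1)%N by rewrite -subn1 subn_gt0 finNzRing_gt1.
have : has #|F|.-1.-primitive_root (enum [set x : F | x != 0]).
  apply: has_prim_root => //; last 2 first.
  - exact: enum_uniq.
  - rewrite -cardE (_ : [set x : F | x != 0] = [set~ 0]) ?cardsC1 //.
    by apply/setP => x; rewrite !inE.
  apply/allP => x; rewrite mem_enum inE => x0.
  by apply/unity_rootP; apply: expf_card_pred.
by case/hasP => g _ gp; exists g.
Qed.

Lemma geometric_polyP (F : fieldType) (k : nat) : (0 < k)%N ->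
  let g0 : {poly F} := \poly_(i < k) 1 in
  [/\ g0 \is monic, size g0 = k, g0.[0] = 1 &
      forall t, ('X * g0).[t] * (t - 1) = t * (t ^+ k - 1)].
Proof.
move=> k0 g0; have sg : size g0 = k by rewrite size_poly_eq ?oner_eq0.
split=> //.
- by rewrite monicE lead_coefE sg coef_poly prednK // leqnn.
- by rewrite horner_coef0 coef_poly k0.
move=> t; rewrite hornerM hornerX -mulrA; congr (_ * _).
rewrite subrX1 mulrC horner_poly; congr (_ * _).
by apply: eq_bigr => i _; rewrite mul1r.
Qed.

(** With [x = 1/z] and [y = t/z], the collision equation multiplied by [t z^k] is
    [z^(k+1) B (t - 1) = c t (t^k - 1)], the Kummer equation times [c (t - 1)]. Solutions with
    [t = 1] give no collision; for them [z] is a root of a polynomial of degree [k + 1]. *)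
Lemma collisions_of_kummer (F : finFieldType) (k : nat) (B c : F) :
  c != 0 -> B != 0 -> (0 < k)%N ->
  (#|[set zt : F * F | (zt.1 != 0%R) &&
       (zt.1 ^+ k.+1 * (B / c) == ('X * \poly_(i < k) 1).[zt.2])%R]| <=
   #|[set xy : F * F | [&& xy.1 != 0%R, xy.2 != 0%R, xy.1 != xy.2 &
      (B / xy.1 + c * xy.1 ^+ k == B / xy.2 + c * xy.2 ^+ k)%R]]| + k.+1)%N.
Proof.
move=> c0 B0 k0; have [_ _ _] := geometric_polyP F k0.
move: (\poly_(i < k) 1) => g0 hg0; set A := [set zt | _]; set C := [set xy | _].
rewrite -(cardsID [set zt : F * F | zt.2 != 1] A) leq_add //.
  pose phi (zt : F * F) := (zt.1^-1, zt.2 / zt.1).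
  rewrite -(card_in_imset (f := phi)).
    apply: subset_leq_card; apply/subsetP => xy /imsetP[[z t]].
    rewrite !inE /= => /andP[/andP[z0 /eqP zt] t1] ->.
    have t0 : t != 0.
      apply: contraTneq (_ : z ^+ k.+1 * (B / c) != 0) => [t0|].
        by rewrite zt t0 hornerM hornerX mul0r eqxx.
      by rewrite !mulf_neq0 ?invr_neq0 ?expf_neq0.
    rewrite /= invr_eq0 z0 mulf_neq0 ?invr_neq0 //=; apply/andP; split.
      rewrite -subr_eq0 -{1}[z^-1]mul1r -mulrBl mulf_neq0 ?invr_neq0 // subr_eq0.
      by rewrite eq_sym.
    have E : z ^+ k.+1 * B * (t - 1) = c * (t * (t ^+ k - 1)).
      by rewrite -hg0 -zt; field.
    have zk0 : z ^+ k != 0 by rewrite expf_neq0.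
    rewrite exprVn expr_div_n -subr_eq0; apply/eqP.
    have -> : B / z^-1 + c / z ^+ k - (B / (t / z) + c * (t ^+ k / z ^+ k)) =
      (z ^+ k.+1 * B * (t - 1) - c * (t * (t ^+ k - 1))) / (t * z ^+ k).
      by rewrite exprS; field; rewrite zk0 t0 z0 oner_eq0.
    by rewrite E subrr mul0r.
  move=> [z t] [z' t']; rewrite !inE /= => /andP[/andP[z0 _] _] _ [] /invr_inj <-.
  by move/(divIf z0) => ->.
have -> : A :\: [set zt : F * F | zt.2 != 1] = [set zt in A | zt.2 == 1].
  by apply/setP => zt; rewrite !inE negbK andbC.
rewrite -(card_in_imset (f := fun zt : F * F => zt.1)); last first.
  move=> [z t] [z' t']; rewrite !inE /= => /andP[_ /eqP ->] /andP[_ /eqP ->] -> //.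
pose p : {poly F} := (B / c) *: 'X^(k.+1) - (('X * g0).[1])%:P.
have sp : size p = k.+2.
  rewrite size_polyDl size_scale ?size_polyXn ?mulf_neq0 ?invr_neq0 //.
  by rewrite size_polyN; apply: leq_ltn_trans (size_polyC_leq1 _) _.
rewrite -ltnS -sp cardE; apply: max_poly_roots; last exact: enum_uniq.
  by rewrite -size_poly_gt0 sp.
apply/allP => z; rewrite mem_enum => /imsetP[[z' t]]; rewrite !inE /=.
move=> /andP[/andP[_ /eqP E] /eqP t1] ->.
by rewrite /root /p hornerD hornerN hornerZ hornerXn hornerC -t1 -E mulrC subrr.
Qed.

(** * From the collision count to the stated inequality *)

Lemma permutation_pair_bound (F : finFieldType) (k n : nat) (c : F) (f : {poly F})
    (a : nat -> F) :
  (2 < #|F|)%N -> (0 < k)%N -> (0 < n)%N -> c != 0 ->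
  permutation_poly (f + c *: 'X^k) -> represents a n f -> alpha a n != 0 -> pole a n = 0 ->
  #|F|%:R <= (n * k.+1 + k)%:R + ((gcdn k.+1 #|F|.-1).-1 * k.-1)%:R * sqrtC #|F|%:R :> algC.
Proof.
move=> q3 k0 n0 c0 pfc [[a0 _] rep] an pn.
have [E [A [B [B0 En E0 Ef]]]] := carlitz_form q3 a0 n0 an pn.
have inj : {in ~: E &, injective (fun x : F => B / x + c * x ^+ k)}.
  move=> x y; rewrite !inE => xE yE Exy; apply: (bij_inj pfc) => /=.
  by rewrite !hornerD !hornerZ !hornerXn !rep !Ef // -!addrA Exy.
have [g gp] := exists_prim_root_card F.
have [g0m sg0 g00 _] := geometric_polyP F k0.
(* The polynomial [h] has degree [k], which is coprime to [k + 1]. *)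
have cop : coprime (gcdn k.+1 #|F|.-1) (size (\poly_(i < k) 1 : {poly F})).
  by rewrite sg0; apply: coprime_dvdl (dvdn_gcdl _ _) _; rewrite coprimeSn.
have d0 : B / c != 0 by rewrite mulf_neq0 ?invr_neq0.
have g000 : (\poly_(i < k) 1 : {poly F}).[0] != 0 by rewrite g00 oner_eq0.
have := kummer_count gp (ltn0Sn k) d0 g0m g000 cop.
move/le_trans; apply; rewrite sg0 lerD2r ler_nat leq_add2r.
apply: leq_trans (collisions_of_kummer c0 B0 k0) _.
apply: leq_trans (leq_add (collision_bound c0 B0 k0 En E0 inj) (leqnn _)) _.
by rewrite -mulSnr prednK.
Qed.

(** When [X < q], both inequalities say that [(q - X)^2 <= D^2 q], a statement about natural numbers
    that does not depend on the field. *)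
Lemma sqrt_bound_transfer (R : rcfType) (q X D : nat) :
  q%:R <= X%:R + D%:R * sqrtC q%:R :> algC ->
  q%:R <= X%:R + D%:R * Num.sqrt q%:R :> R.
Proof.
move=> H; have [qX|Xq] := leqP q X.
  by apply: ler_wpDr; rewrite ?mulr_ge0 ?ler0n ?sqrtr_ge0 // ler_nat.
have {}H : ((q - X) ^ 2 <= D ^ 2 * q)%N.
  rewrite -(ler_nat algC) natrM !natrX natrB ?(ltnW Xq) // -[X in _ <= _ * X]sqrtCK -exprMn.
  by rewrite lerXn2r ?nnegrE ?subr_ge0 ?ler_nat ?(ltnW Xq) ?mulr_ge0
    ?ler0n ?sqrtC_ge0 ?ler0n // lerBlDl.
rewrite -lerBlDl -(ler_pXn2r (n := 2)) ?nnegrE ?subr_ge0 ?ler_nat ?(ltnW Xq) //; last first.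
  by rewrite mulr_ge0 ?ler0n ?sqrtr_ge0.
by rewrite exprMn sqr_sqrtr ?ler0n // -natrB ?(ltnW Xq) // -!natrX -natrM ler_nat.
Qed.

Theorem theorem3p1 (R : rcfType) (p r q : nat) (hp : prime p) (hr : (1 <= r)%N)
    (hqpr : q = (p ^ r)%N) (hq : (3 <= q)%N)
    (F : finFieldType) (hF : #|F| = q)
    (k : nat) (hk : (1 <= k < q - 1)%N) (c : F) (hc : c != 0)
    (f : {poly F}) (hf : permutation_poly f)
    (hfc : permutation_poly (f + c *: 'X^k))
    (n : nat) (hn : (1 <= n)%N) (hrank : is_carlitz_rank f n)
    (hL2 : class_L2 f)
    (m : nat) (hm : m = gcdn (k + 1) (q - 1)) :
  k%:R * (n%:R + 3) + (k%:R - 1) * (m%:R - 1) * Num.sqrt (q%:R : R)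
    >= q%:R - n%:R
  /\ (m = 1%N -> (k%:R : R) >= (q%:R - n%:R) / (n%:R + 3)).
Proof.
have k0 : (0 < k)%N by case/andP: hk.
have m0 : (0 < m)%N by rewrite hm gcdn_gt0 addn1.
have [_ [n' [_ [[a' rep'] min'] [a [rep an pn]]]]] := hL2.
(* Minimality of the rank identifies the index provided by [class_L2] with [n]. *)
have En : n' = n.
  have [[b repb] minb] := hrank.
  by apply/eqP; rewrite eqn_leq (min' _ _ repb) (minb _ _ rep').
rewrite {}En in rep an pn.
have q3 : (2 < #|F|)%N by rewrite hF.
have bound : (q%:R : R) - n%:R <=
    k%:R * (n%:R + 3) + (k%:R - 1) * (m%:R - 1) * Num.sqrt (q%:R : R).
  have := sqrt_bound_transfer R (permutation_pair_bound q3 k0 hn hc hfc rep an pn).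
  have -> : gcdn k.+1 #|F|.-1 = m by rewrite hm hF addn1 subn1.
  rewrite hF => H; rewrite lerBlDr; apply: le_trans H _.
  rewrite natrD 2!natrM -natr1 -!subn1 !natrB //.
  have -> : (m%:R - 1) * (k%:R - 1) = (k%:R - 1) * (m%:R - 1) :> R by rewrite mulrC.
  (* The bound obtained is sharper than the stated one by [2 k]. *)
  rewrite -subr_ge0 (_ : _ - _ = 2 * k%:R); last by ring.
  by rewrite mulr_ge0 ?ler0n.
split=> // m1; rewrite m1 subrr mulr0 mul0r addr0 in bound.
by rewrite ler_pdivrMr // ltr_wpDl ?ler0n.
Qed.
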